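(* Let $F=F(a_1,\dots,a_k)$ where $k\ge2$. Let $\phi:F\to Aut(X)$ be a free minimal action of $F$ on a simplicial tree $X$ without inversions. Then exactly one of the following occurs: (1) There is a simple automorphism $\alpha$ of $F$ such that $X$, with the action $\phi\circ\alpha$ of $F$, is $F$-equivariantly isomorphic to the Cayley graph of $F$ with respect to $\{a_1,\dots,a_k\}$. In this case $\lambda(\phi)=1$. (2) We have $\lambda(\phi)\ge1+\frac{1}{k(2k-1)}$.
   Context: Let $A=\{a_1,\dots,a_k\}$. The action is by simplicial automorphisms; minimal means that $X$ has no proper $F$-invariant subtree. An automorphism of $F$ is a relabeling automorphism if it is induced by a permutation of $\{a_1,\dots,a_k\}^{\pm1}$; it is simple if it is the composition of a relabeling automorphism and an inner automorphism. A simplicial tree is given the path metric $d$ in which every edge has length $1$. $\partial F$ is the set of semi-infinite freely reduced words over $A^{\pm1}$; $\omega_n\in F$ is the initial segment of length $n$ of $\omega\in\partial F$; $\mu_A$ is the Borel probability measure on $\partial F$ giving the set of all $\omega$ beginning with a freely reduced word $v\neq1$ the mass $\frac{1}{2k(2k-1)^{|v|-1}}$. The generic stretching factor $\lambda(\phi)$ is the constant such that, for any $x\in X$, $\lim_{n\to\infty}\frac{d(x,\phi(\omega_n)x)}{n}=\lambda(\phi)$ for $\mu_A$-a.e. $\omega\in\partial F$; it exists and does not depend on $x$. *)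

(* Defs.v *)
From HB Require Import structures.
From mathcomp Require Import all_boot all_order all_algebra all_fingroup.
From mathcomp Require Import all_classical all_reals all_analysis.
Import Order.TTheory GRing.Theory Num.Theory.
Import numFieldNormedType.Exports.

Set Implicit Arguments.
Unset Strict Implicit.
Unset Printing Implicit Defensive.

Local Open Scope classical_set_scope.
Local Open Scope ring_scope.

(* The alphabet A^{+-1}: (i, false) stands for a_i and (i, true) for its
   inverse. *)
Definition letter (k : nat) : Type := ('I_k * bool)%type.

Section FreeGroup.
Variable k : nat.
Implicit Types (x : letter k) (s t u : seq (letter k)).

Definition linv x : letter k := (x.1, ~~ x.2).

Definition reduced s := sorted (fun x y => y != linv x) s.

(* [push x s] is the reduced form of x :: s, for s reduced. *)
Definition push x s :=
  if s is y :: s' then if y == linv x then s' else x :: s else [:: x].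

Definition pushes t s := foldr push s t.

Definition word_inv s := rev (map linv s).

Lemma linvK : involutive linv.
Proof. by case=> i b; rewrite /linv /= negbK. Qed.

Lemma reduced_push x s : reduced s -> reduced (push x s).
Proof.
case: s => [//|y s] /= rs; case: ifP => [_|/negbT nyx].
  exact: path_sorted rs.
by rewrite /= nyx.
Qed.

Lemma reduced_pushes t s : reduced s -> reduced (pushes t s).
Proof. by move=> rs; elim: t => //= x t; exact: reduced_push. Qed.

Lemma reduced_inv s : reduced s -> reduced (word_inv s).
Proof.
move=> rs; rewrite /reduced rev_sorted sorted_map.
move: rs; rewrite /reduced; apply: sub_sorted => x y /=.
by apply: contraNN => /eqP ->; rewrite linvK.
Qed.

Lemma pushK x s : reduced s -> push (linv x) (push x s) = s.
Proof.
case: s => [|y s] /= rs; first by rewrite linvK eqxx.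
case: ifP => [/eqP yx|_] /=; last by rewrite linvK eqxx.
case: s rs => [|z s] /=; rewrite yx // => /andP[].
by move=> /negPf ->.
Qed.

Lemma pushes_push x t s :
  reduced s -> pushes (push x t) s = push x (pushes t s).
Proof.
move=> rs; case: t => [//|y t] /=; case: ifP => //= /eqP ->.
by have := pushK (linv x) (reduced_pushes t rs); rewrite linvK.
Qed.

Lemma pushesA t u s :
  reduced s -> pushes (pushes t u) s = pushes t (pushes u s).
Proof. by move=> rs; elim: t => //= x t <-; rewrite pushes_push. Qed.

Lemma pushes_nil s : reduced s -> pushes s [::] = s.
Proof.
elim: s => //= x s IHs rs; rewrite IHs; last exact: path_sorted rs.
by case: s rs {IHs} => //= y s /andP[/negPf ->].
Qed.

Lemma pushes_inv s : pushes (word_inv s) s = [::].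
Proof.
elim: s => //= x s IHs.
by rewrite /word_inv /= rev_cons /pushes foldr_rcons /= linvK eqxx; exact: IHs.
Qed.

(* The free group F(a_1, ..., a_k), as the set of freely reduced words. *)
Definition free_group : Type := {s : seq (letter k) | reduced s}.

HB.instance Definition _ := Choice.on free_group.

Definition fg_one : free_group := exist (fun s => reduced s) [::] isT.
Definition fg_inv (g : free_group) : free_group :=
  exist (fun s => reduced s) (word_inv (val g)) (reduced_inv (valP g)).
Definition fg_mul (g h : free_group) : free_group :=
  exist (fun s => reduced s) (pushes (val g) (val h))
    (reduced_pushes (val g) (valP h)).

Lemma fg_mulA : associative fg_mul.
Proof.
by move=> f g h; apply: val_inj; rewrite /= pushesA //; exact: (valP h).
Qed.

Lemma fg_mul1 : left_id fg_one fg_mul.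
Proof. by move=> g; exact: val_inj. Qed.

Lemma fg_mulr1 : right_id fg_one fg_mul.
Proof. by move=> g; apply: val_inj; rewrite /= pushes_nil //; exact: (valP g). Qed.

Lemma fg_mulV : left_inverse fg_one fg_inv fg_mul.
Proof. by move=> g; apply: val_inj; rewrite /= pushes_inv. Qed.

Lemma fg_mulrV : right_inverse fg_one fg_inv fg_mul.
Proof.
move=> g; rewrite -[RHS](fg_mulV (fg_inv g)); congr fg_mul.
by apply: val_inj; rewrite /= /word_inv map_rev revK mapK //; exact: linvK.
Qed.

HB.instance Definition _ :=
  isGroup.Build free_group fg_mulA fg_mul1 fg_mulr1 fg_mulV fg_mulrV.

Definition gen (x : letter k) : free_group :=
  exist (fun s => reduced s) [:: x] isT.

Definition wlen (g : free_group) : nat := size (val g).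

End FreeGroup.

Section SimpleAutomorphisms.
Variable k : nat.
Implicit Types alpha : free_group k -> free_group k.

Definition is_automorphism alpha :=
  {morph alpha : g h / (g * h)%g} /\ bijective alpha.

Definition is_relabeling alpha :=
  is_automorphism alpha /\
  exists sigma : {perm letter k}, forall x, alpha (gen x) = gen (sigma x).

Definition is_inner alpha :=
  exists g : free_group k, forall h, alpha h = (h ^ g)%g.

Definition is_simple alpha :=
  exists rho iota : free_group k -> free_group k,
    [/\ is_relabeling rho, is_inner iota & alpha =1 iota \o rho].

End SimpleAutomorphisms.

(* A simplicial tree is given by its vertex set V and adjacency relation e;
   in particular points x of the tree are vertices. *)
Section Trees.
Variables (V : eqType) (e : rel V).

Definition is_tree :=
  [/\ inhabited V, symmetric e, irreflexive e,
      forall x y, exists2 p, path e x p & last x p = y &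
      forall c, ucycle e c -> (size c <= 2)%N].

Definition is_subtree (S : set V) :=
  S !=set0 /\
  forall x y, S x -> S y ->
    exists p, [/\ path e x p, last x p = y & forall z, z \in p -> S z].

Definition path_dist (R : realType) (x y : V) : R :=
  inf [set (size p)%:R | p in [set p | path e x p /\ last x p = y]].

Variables (G : groupType) (phi : G -> V -> V).

Definition is_simplicial_action :=
  [/\ forall x, phi 1%g x = x,
      forall g h x, phi (g * h)%g x = phi g (phi h x) &
      forall g x y, e (phi g x) (phi g y) = e x y].

Definition without_inversions :=
  forall g x y, e x y -> ~ (phi g x = y /\ phi g y = x).

Definition is_free := forall g x, phi g x = x -> g = 1%g.

Definition is_minimal :=
  forall S : set V, is_subtree S -> (forall g x, S x -> S (phi g x)) ->
    S = setT.

End Trees.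

Definition cayley_adj (k : nat) : rel (free_group k) :=
  fun g h => [exists x : letter k, h == (g * gen x)%g].

Definition cayley_isomorphic (k : nat) (V : eqType) (e : rel V)
    (psi : free_group k -> V -> V) :=
  exists f : free_group k -> V,
    [/\ bijective f,
        forall g h, e (f g) (f h) = cayley_adj g h &
        forall g h, f (g * h)%g = psi g (f h)].

Section Boundary.
Variable k : nat.

Definition words := prod_topology (fun _ : nat => discrete_topology (letter k)).

Definition inf_reduced : set words :=
  [set w | forall n, w n.+1 != linv (w n)].

(* The boundary, with the subspace topology. The argument hk only serves to
   make the type nonempty, hence pointed, as measurable types must be. *)
Definition boundary (hk : (2 <= k)%N) : Type := set_type inf_reduced.

Variable hk : (2 <= k)%N.

HB.instance Definition _ := Topological.on (boundary hk).

Definition letter0 : letter k := (Ordinal (ltnW hk), false).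

Definition word0 : words := fun _ : nat => letter0.

Lemma word0_reduced : word0 \in inf_reduced.
Proof. by apply/mem_set => n; apply/eqP => -[]. Qed.

HB.instance Definition _ :=
  isPointed.Build (boundary hk)
    (exist (fun w => w \in inf_reduced) word0 word0_reduced).

Definition boundary_borel := g_sigma_algebraType (@open (boundary hk)).

Lemma reduced_prefix (w : boundary hk) n : reduced (mkseq (set_val w) n).
Proof.
apply/(sortedP letter0) => i; rewrite size_mkseq => ilt.
rewrite !nth_mkseq //; last exact: ltnW.
exact: (set_mem (valP w)).
Qed.

Definition wprefix (w : boundary hk) (n : nat) : free_group k :=
  exist (fun s => reduced s) (mkseq (set_val w) n) (reduced_prefix w n).

Definition cylinder (v : free_group k) : set (boundary hk) :=
  [set w | wprefix w (wlen v) = v].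

Variable R : realType.

(* These cylinder masses determine the probability measure mu. *)
Definition is_uniform (mu : probability boundary_borel R) :=
  forall v : free_group k, v != 1%g ->
    mu (cylinder v) =
      ((2 * k%:R * (2 * k%:R - 1) ^+ (wlen v).-1)^-1)%:E.

Variables (V : eqType) (e : rel V) (phi : free_group k -> V -> V).

Definition is_stretching_factor (mu : probability boundary_borel R) (l : R) :=
  forall x : V, {ae mu, forall w,
    (fun n => path_dist e R x (phi (wprefix w n) x) / n%:R) @ \oo --> l}.

(* The generic stretching factor lambda(phi): the l singled out by
   [is_stretching_factor], and 0 should none exist. *)
Definition stretching_factor (mu : probability boundary_borel R) : R :=
  xget 0 [set l | is_stretching_factor mu l].

End Boundary.

(* Main.v *)
(** Fix a vertex [x] of [X]. For an edge of [X] let [H] be the set of [g] in [F]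
    such that [g x] lies beyond this edge. Since [F] acts freely, [H] has finite
    edge boundary in the Cayley graph of [F], hence is determined by a clopen set
    of ends, and an occurrence of a word joining the two sides of this set makes
    the path from [x] to [w_n x] cross a translate of the edge. Therefore
    [lambda] is at least the sum, over the orbits of edges, of the mass of the
    geodesics of [F] joining the two sides of [H] (for the shift-invariant
    measure of total mass one per unit length). An isoperimetric inequality
    bounds each such mass from below by [1 / k], and by
    [1 / k + 1 / (k (2k - 1))] unless [H] is a half-tree up to a finite set. As
    [H^1(F, Z/2)] has dimension [k] there are at least [k] orbits of edges, so if
    [lambda < 1 + 1 / (k (2k - 1))] there are exactly [k] orbits and all sets [H]
    are almost half-trees. Orienting every edge of [X] towards the side whose
    half-tree contains [1] then singles out a vertex [y] which every generator
    moves to a neighbour, and [g |-> g y] identifies the Cayley graph with [X].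

    The limit defining [lambda] exists because
    [d(x, w_(n+1) x) - d(x, w_n x)] depends only on boundedly many of the last
    letters of [w_(n+1)], and the frequencies of words in a random end converge. *)

Require Import Defs.
From mathcomp Require Import all_boot all_order all_algebra all_fingroup.
From mathcomp Require Import all_classical all_reals all_analysis.
From mathcomp Require Import measurable_realfun zify ring lra.
Import Order.TTheory GRing.Theory Num.Theory.
Import numFieldNormedType.Exports.

Set Implicit Arguments.
Unset Strict Implicit.
Unset Printing Implicit Defensive.

(** * Words in the free group *)

(** Every edge is studied on a single sphere of the Cayley graph. Once the radius [N] exceeds the
    coboundary of [H], membership in [H] is constant on each cone over a word of length [N], and the
    mass of geodesics joining the two sides is a finite sum over pairs of such words. Write
    [q = 2k - 1]. Two words of length [N = n + 1] with common prefix of length [c] are joined by a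
    geodesic of [2N - 2c] letters, whose cylinder has mass [q^(2c) / (2k q^(2n+1))]. With both
    orientations counted, an edge contributes [cost / (k q^(2n+1))], so lower bounds [q^(2n+1)] and
    [q^(2n+1) + q^(2n)] on the cost become [1/k] and [1/k + 1/(kq)]. Minimality and the absence of
    inversions make [H] and its complement both meet the sphere; the absence of inversions also puts
    the two orientations of an edge in different orbits. The frequencies come from a second moment
    estimate: occurrences of [va], less [1/q] times those of [v], form a martingale with bounded
    increments. This determines frequencies of long words from short ones, and those of single
    letters from linear relations. *)

Section Words.
Variable k : nat.
Implicit Types (a b x : letter k) (s t u v p : seq (letter k)) (g h : free_group k).

Lemma linv_neq a : linv a != a.
Proof. by case: a => i [] /=; apply/eqP => -[]. Qed.

Lemma reduced_cat s t :
  reduced (s ++ t) =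
  [&& reduced s, reduced t &
      if s is _ :: _ then (if t is b :: _ then b != linv (last b s) else true)
      else true].
Proof.
case: s => [|a s]; first by rewrite andbT.
case: t => [|b t]; first by rewrite cats0 !andbT.
by rewrite /reduced /= cat_path /= (andbC (_ != _)).
Qed.

Lemma reduced_catl s t : reduced (s ++ t) -> reduced s.
Proof. by rewrite reduced_cat => /and3P[]. Qed.

Lemma reduced_catr s t : reduced (s ++ t) -> reduced t.
Proof. by rewrite reduced_cat => /and3P[]. Qed.

Lemma reduced_take n s : reduced s -> reduced (take n s).
Proof. by rewrite -{1}(cat_take_drop n s) => /reduced_catl. Qed.

Lemma reduced_drop n s : reduced s -> reduced (drop n s).
Proof. by rewrite -{1}(cat_take_drop n s) => /reduced_catr. Qed.

Lemma reduced_rcons s a b : reduced (rcons (rcons s a) b) = reduced (rcons s a) && (b != linv a).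
Proof.
rewrite -[rcons _ b]cats1 reduced_cat /= last_rcons.
by case: s => [|c s] //=; rewrite last_rcons.
Qed.

Lemma reduced_overlap s t u :
  t != [::] -> reduced (s ++ t) -> reduced (t ++ u) -> reduced (s ++ t ++ u).
Proof.
case: t => // a t _; rewrite [in X in X -> _]reduced_cat [in X in _ -> _ -> X]reduced_cat.
by move=> /and3P[-> _ h] ->.
Qed.

(** Total on words, by free reduction, so that no proof of reducedness has to be carried along. *)
Definition fgw s : free_group k :=
  exist (fun s => reduced s) (pushes s [::]) (reduced_pushes s (isT : reduced [::])).

Lemma val_fgw s : reduced s -> val (fgw s) = s.
Proof. exact: pushes_nil. Qed.

Lemma fgwK g : fgw (val g) = g.
Proof. by apply: val_inj; rewrite val_fgw //; exact: (valP g). Qed.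

Lemma fgw_cat s t : fgw (s ++ t) = (fgw s * fgw t)%g.
Proof.
apply: val_inj; rewrite /= pushesA; last exact: reduced_pushes.
by rewrite /pushes foldr_cat.
Qed.

Lemma fgw_nil : fgw [::] = 1%g.
Proof. exact: val_inj. Qed.

Lemma fgw1 a : fgw [:: a] = gen a.
Proof. exact: val_inj. Qed.

Lemma fgw_cons a s : fgw (a :: s) = (gen a * fgw s)%g.
Proof. by rewrite -cat1s fgw_cat fgw1. Qed.

Lemma fgw_rcons s a : fgw (rcons s a) = (fgw s * gen a)%g.
Proof. by rewrite -cats1 fgw_cat fgw1. Qed.

Lemma fgw_inv s : reduced s -> (fgw s)^-1%g = fgw (word_inv s).
Proof. by move=> rs; apply: val_inj; rewrite val_fgw /= ?pushes_nil //; exact: reduced_inv. Qed.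

Lemma gen_linv a : gen (linv a) = (gen a)^-1%g.
Proof. by apply: val_inj; rewrite /= /word_inv. Qed.

Lemma wlen_eq0 g : (wlen g == 0) = (g == 1%g).
Proof.
apply/idP/eqP => [|->//]; rewrite /wlen size_eq0 => /eqP g0.
exact: val_inj.
Qed.

Lemma wlen_inv g : wlen g^-1%g = wlen g.
Proof. by rewrite /wlen /= /word_inv size_rev size_map. Qed.

Lemma size_pushes s t : size (pushes s t) <= size s + size t.
Proof.
elim: s => //= a s IHs; rewrite addSn.
apply: (@leq_trans (size (pushes s t)).+1); last by [].
by case: (pushes s t) => //= b u; case: ifP => //= _; exact: leqW.
Qed.

Lemma wlenM g h : wlen (g * h)%g <= wlen g + wlen h.
Proof. exact: size_pushes. Qed.

Lemma wlen_gen a : wlen (gen a) = 1.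
Proof. by []. Qed.

Lemma wlen_fgw s : reduced s -> wlen (fgw s) = size s.
Proof. by move=> rs; rewrite /wlen val_fgw. Qed.

Lemma free_group_ind (P : free_group k -> Prop) :
  P 1%g -> (forall g a, P g -> P (g * gen a)%g) -> forall g, P g.
Proof.
move=> P1 PS g; rewrite -(fgwK g); elim/last_ind: (val g) => [|s a IHs].
  by rewrite fgw_nil.
by rewrite fgw_rcons; exact: PS.
Qed.

(** The sphere of radius [n], grown at the end of the words so that a sum over one level splits over
    the children of the level before. *)
Fixpoint rwords n : seq (seq (letter k)) :=
  if n is m.+1 then
    [seq rcons s a | s <- rwords m,
                     a <- [seq a <- enum {: letter k} | reduced (rcons s a)]]
  else [:: [::]].

Lemma mem_rwords n s : (s \in rwords n) = reduced s && (size s == n).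
Proof.
elim: n s => [|n IHn] s /=.
  by rewrite inE size_eq0; case: s => //= b s; rewrite andbF.
apply/allpairsPdep/andP => [[t [a []]]|].
  rewrite IHn mem_filter => /andP[_ /eqP <-] /andP[rta _] ->.
  by rewrite size_rcons.
case: (lastP s) => [[]//|t a]; rewrite size_rcons eqSS => -[rta stn].
exists t, a; rewrite IHn stn andbT mem_filter rta mem_enum; split => //.
by move: rta; rewrite -cats1 => /reduced_catl.
Qed.

Lemma rwords_uniq n : uniq (rwords n).
Proof.
elim: n => //= n IHn; apply: allpairs_uniq_dep => //.
  by move=> s _; rewrite filter_uniq ?enum_uniq.
move=> [s a] [t b] /= _ _ /rcons_inj[-> ->] //.
Qed.

End Words.

Arguments rwords : simpl never.

(** * Edge boundaries of sets of ends *)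

Section Lcp.
Variable T : eqType.
Implicit Types s t : seq T.

Fixpoint lcp s t : nat :=
  match s, t with
  | a :: s', b :: t' => if a == b then (lcp s' t').+1 else 0
  | _, _ => 0
  end.

Lemma lcpC s t : lcp s t = lcp t s.
Proof. by elim: s t => [|a s IHs] [|b t] //=; rewrite eq_sym IHs. Qed.

Lemma lcpxx s : lcp s s = size s.
Proof. by elim: s => //= a s ->; rewrite eqxx. Qed.

(** The case [s = t] is included: two children of one vertex branch at that vertex. Hence the cost
    at one level is a quadratic form, diagonal terms included, in the numbers of children. *)
Lemma lcp_rcons s t a b :
  size s = size t -> rcons s a != rcons t b ->
  lcp (rcons s a) (rcons t b) = lcp s t.
Proof.
elim: s t => [|c s IHs] [|d t] //=.
  by move=> _; rewrite eqseq_cons eqxx andbT => /negPf ->.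
move=> [] st; rewrite eqseq_cons negb_and.
by case: eqVneq => //= _ /IHs ->.
Qed.

Lemma lcp_size s t : lcp s t <= size s.
Proof. by elim: s t => [|a s IHs] [|b t] //=; case: eqP => //= _; exact: IHs. Qed.

End Lcp.

Section CutCost.
Variables (T : eqType) (r : seq T) (K : T -> T -> nat) (q : nat).
Hypothesis r_uniq : uniq r.

Definition wcost (j : T -> nat) :=
  \sum_(x <- r) \sum_(y <- r) j x * (q - j y) * K x y.

(** Isolates the variable [j v], in which the form is a concave quadratic. *)
Lemma wcost_split v j : v \in r ->
  wcost j = j v * (q - j v) * K v v
    + j v * \sum_(y <- r | y != v) (q - j y) * K v y
    + (q - j v) * \sum_(x <- r | x != v) j x * K x v
    + \sum_(x <- r | x != v) \sum_(y <- r | y != v) j x * (q - j y) * K x y.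
Proof.
move=> rv; rewrite /wcost (bigD1_seq v) //= (bigD1_seq v) //=.
rewrite -!addnA; congr (_ + _); rewrite big_distrr /=.
congr (_ + _); first by apply: eq_bigr => y _; rewrite mulnA.
rewrite [X in _ = X + _]big_distrr /= -big_split /=; apply: eq_bigr => x xv.
rewrite (bigD1_seq v) //=; congr (_ + _).
by rewrite mulnA [in RHS](mulnC (q - _)).
Qed.

End CutCost.

(** The arithmetic of the inductive step. Of the [q] children of a vertex, [e.+2] lie in the set and
    [d.+1] do not; [A] and [B] are the weights joining the vertex to the rest of the set and of its
    complement, and [A + B] is also the diagonal weight. In [fill_out_gain] a single child lies in
    the set; [letter_cut_gain] serves spheres of radius one. *)
Lemma fill_in_gain d e A B R :
  (e.+2 + d.+1) * B + R + (A + B) <=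
  e.+2 * d.+1 * (A + B) + e.+2 * B + d.+1 * A + R.
Proof.
have -> : e.+2 * d.+1 * (A + B) = e * d * A + e * d * B + d * A + d * B + d * A + d * B + e * A + e * B + 2 * A + 2 * B by ring.
have -> : (e.+2 + d.+1) * B = e * B + d * B + 3 * B by ring.
have -> : e.+2 * B = e * B + 2 * B by ring.
lia.
Qed.

Lemma fill_out_gain d A B R :
  d.+3 * A + R + (A + B) <= 1 * d.+2 * (A + B) + 1 * B + d.+2 * A + R.
Proof.
have -> : 1 * d.+2 * (A + B) = d * A + d * B + 2 * A + 2 * B by ring.
have -> : d.+3 * A = d * A + 3 * A by ring.
have -> : d.+2 * A = d * A + 2 * A by ring.
lia.
Qed.
Lemma letter_cut_gain e d : e.+2 + d.+1 + 1 <= e.+2 * d.+2.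
Proof.
have -> : e.+2 * d.+2 = e * d + 2 * e + 2 * d + 4 by ring.
lia.
Qed.

(** * The isoperimetric inequality on spheres *)

Section Isoperimetry.
Variable k : nat.
Hypothesis hk : 2 <= k.
Implicit Types (a b : letter k) (s t u v p : seq (letter k)).
Implicit Type U : seq (letter k) -> bool.

Let q := (2 * k).-1.

(* For distinct words [s] and [t] of the same length, this is up to a constant
   factor the mass of the geodesics of the Cayley graph through [s] and [t]. *)
Definition lcp_ker s t := q ^ (2 * lcp s t).

Definition ext s := [seq a <- enum {: letter k} | reduced (rcons s a)].

Lemma big_rwordsS (R : Type) (idx : R) (op : Monoid.com_law idx) n (F : seq (letter k) -> R) :
  \big[op/idx]_(p <- rwords k n.+1) F p =
  \big[op/idx]_(v <- rwords k n) \big[op/idx]_(a <- ext v) F (rcons v a).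
Proof. by rewrite big_allpairs_dep. Qed.

Lemma card_letter : #|{: letter k}| = 2 * k.
Proof. by rewrite card_prod card_ord card_bool mulnC. Qed.

Lemma size_ext_nil : size (ext [::]) = 2 * k.
Proof. by rewrite /ext filter_predT -cardE card_letter. Qed.

Lemma ext_uniq s : uniq (ext s).
Proof. by rewrite filter_uniq ?enum_uniq. Qed.

Lemma mem_ext s a : (a \in ext s) = reduced (rcons s a).
Proof. by rewrite mem_filter mem_enum andbT. Qed.

Lemma size_ext s : reduced s -> s != [::] -> size (ext s) = q.
Proof.
case: (lastP s) => // {}s b rs _; rewrite /q -card_letter.
rewrite -(cardC1 (linv b)) cardE; apply: perm_size.
apply: uniq_perm; [exact: ext_uniq|exact: enum_uniq|move=> a].
by rewrite mem_ext mem_enum reduced_rcons rs.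
Qed.

Lemma size_ext_rwords n s : s \in rwords k n.+1 -> size (ext s) = q.
Proof.
rewrite mem_rwords => /andP[rs /eqP ss]; rewrite size_ext //.
by rewrite -size_eq0 ss.
Qed.

Lemma lcp_ker_rcons s t a b : size s = size t -> rcons s a != rcons t b ->
  lcp_ker (rcons s a) (rcons t b) = lcp_ker s t.
Proof. by move=> st neq; rewrite /lcp_ker lcp_rcons. Qed.

Lemma lcp_kerC s t : lcp_ker s t = lcp_ker t s.
Proof. by rewrite /lcp_ker lcpC. Qed.

Lemma lcp_kerxx n s : s \in rwords k n -> lcp_ker s s = q ^ (2 * n).
Proof. by rewrite mem_rwords /lcp_ker lcpxx => /andP[_ /eqP ->]. Qed.

Lemma size_rwords n s : s \in rwords k n -> size s = n.
Proof. by rewrite mem_rwords => /andP[_ /eqP]. Qed.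

Lemma rwords_rconsP n p : reflect
  (exists s a, [/\ s \in rwords k n, a \in ext s & p = rcons s a])
  (p \in rwords k n.+1).
Proof. exact: allpairsPdep. Qed.

Lemma q_gt0 : 0 < q. Proof. rewrite /q; lia. Qed.

Lemma sum_neq_const (T : eqType) (r : seq T) x c : uniq r -> x \in r ->
  \sum_(y <- r) (if y != x then c else 0) = (size r).-1 * c.
Proof.
move=> ur rx; rewrite -big_mkcond /= big_const_seq iter_addn_0.
have := count_predC (pred1 x) r; rewrite count_uniq_mem // rx => <- /=.
by rewrite mulnC.
Qed.

(** By induction: the [q - 1] siblings of [v] weigh [q ^ (2 * n)] each, and each word at the
    parent's level other than the parent counts [q] times. Multiplied by [q], the sum equals the
    diagonal weight [lcp_ker v v], the balance on which the gain in [isoperimetry] rests. *)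
Lemma lcp_ker_sum n v : v \in rwords k n.+1 ->
  \sum_(p <- rwords k n.+1 | p != v) lcp_ker v p = q ^ (2 * n).+1.
Proof.
elim: n v => [|n IHn] v /rwords_rconsP[u [a [ru ua ->]]];
  rewrite big_mkcond big_rwordsS.
  rewrite /rwords in ru *; rewrite big_seq1; move: ru ua; rewrite inE => /eqP -> ua.
  rewrite (eq_bigr (fun b => if b != a then 1 else 0)).
    by rewrite sum_neq_const ?ext_uniq // size_ext_nil muln1 muln0 expn1.
  move=> b _; rewrite /= /lcp_ker /= eqseq_cons andbT (eq_sym a).
  by case: eqVneq.
rewrite (bigD1_seq u) ?rwords_uniq //=.
rewrite (eq_bigr (fun b => if b != a then q ^ (2 * n.+1) else 0)); last first.
  move=> b _; rewrite eqseq_rcons eqxx /=; case: eqVneq => //= ba.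
  by rewrite lcp_ker_rcons ?eqseq_rcons ?(eq_sym a) ?(negPf ba) ?eqxx // (lcp_kerxx ru).
rewrite sum_neq_const ?ext_uniq // (size_ext_rwords ru).
rewrite big_seq_cond (eq_bigr (fun s => q * lcp_ker u s)); last first.
  move=> s /andP[rs su]; rewrite (eq_bigr (fun=> lcp_ker u s)).
    by rewrite big_const_seq iter_addn_0 count_predT (size_ext_rwords rs) mulnC.
  move=> b _; have neq: rcons s b != rcons u a by rewrite eqseq_rcons (negPf su).
  by rewrite neq lcp_ker_rcons 1?eq_sym // (size_rwords rs) (size_rwords ru).
rewrite -big_seq_cond -big_distrr /= IHn //.
have -> : (2 * n.+1).+1 = (2 * n).+3 by lia.
have -> : 2 * n.+1 = (2 * n).+2 by lia.
rewrite !expnS; have := q_gt0; case: (q) => // m _ /=; ring.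
Qed.

Definition cost n U :=
  \sum_(p <- rwords k n) \sum_(p' <- rwords k n) (U p && ~~ U p') * lcp_ker p p'.

Definition nbin U v := \sum_(a <- ext v) U (rcons v a).

Lemma nbin_le U v : nbin U v <= size (ext v).
Proof. by rewrite -sum1_size; apply: leq_sum => a _; case: (U _). Qed.

Lemma nbinC U v : \sum_(a <- ext v) ~~ U (rcons v a) = size (ext v) - nbin U v.
Proof.
rewrite -sum1_size -sumnB; last by move=> a _; case: (U _).
by apply: eq_bigr => a _; case: (U _).
Qed.

Lemma cost_rec n U :
  cost n.+1 U = \sum_(v <- rwords k n) \sum_(v' <- rwords k n)
     nbin U v * (size (ext v') - nbin U v') * lcp_ker v v'.
Proof.
rewrite /cost big_rwordsS; apply: eq_big_seq => v rv.
under eq_bigr do rewrite big_rwordsS.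
rewrite exchange_big /=; apply: eq_big_seq => v' rv'.
rewrite -nbinC /nbin !big_distrl /=.
apply: eq_bigr => a _; rewrite big_distrr big_distrl /=; apply: eq_bigr => b _.
rewrite mulnb; have [/andP[Ua Ub]|_] := boolP (_ && _); last by rewrite !mul0n.
rewrite lcp_ker_rcons //; first by rewrite (size_rwords rv) (size_rwords rv').
by apply: contraNneq Ub => <-.
Qed.

Lemma cost_wcost n U :
  cost n.+2 U = wcost (rwords k n.+1) lcp_ker q (nbin U).
Proof.
rewrite cost_rec; apply: eq_big_seq => v rv; apply: eq_big_seq => v' rv'.
by rewrite (size_ext_rwords rv').
Qed.

Lemma costC n U : cost n (predC U) = cost n U.
Proof.
rewrite /cost exchange_big; apply: eq_bigr => p _; apply: eq_bigr => p' _ /=.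
by rewrite negbK andbC lcp_kerC.
Qed.

(** The bit [c] allows for the complement of a cone. *)
Definition half_tree n U := exists u c,
  [/\ reduced u, u != [::], size u <= n &
      forall p, p \in rwords k n -> U p = c (+) prefix u p].

Lemma half_treeC n U : half_tree n (predC U) -> half_tree n U.
Proof.
move=> [u [c [ru u0 un Uu]]]; exists u, (~~ c); split=> // p rp.
by rewrite addNb -Uu //= negbK.
Qed.

Lemma nbin0P U v a : nbin U v = 0 -> a \in ext v -> U (rcons v a) = false.
Proof.
move=> /eqP; rewrite sum_nat_seq_eq0 => /allP U0 /U0 /=.
by case: (U _).
Qed.

Lemma nbinCE U v : nbin (predC U) v = size (ext v) - nbin U v.
Proof. by rewrite -nbinC. Qed.

Lemma nbin_fullP U v a : nbin U v = size (ext v) -> a \in ext v -> U (rcons v a).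
Proof.
move=> Uv av; have := @nbin0P (predC U) v a; rewrite nbinCE Uv subnn => /(_ erefl av).
by move/negbFE.
Qed.

Lemma nbin1P U v : nbin U v = 1 ->
  exists2 a, a \in ext v & {in ext v, forall b, U (rcons v b) = (b == a)}.
Proof.
have -> : nbin U v = count (fun a => U (rcons v a)) (ext v).
  by rewrite -sum1_count big_mkcond; apply: eq_bigr => a _; case: (U _).
rewrite -size_filter; set s := seq.filter _ (ext v); case sa: s => [|a [|? ?]] // _.
have sE b : (b \in ext v) && U (rcons v b) = (b == a).
  by rewrite andbC -(mem_filter (fun b => U (rcons v b))) -/s sa inE.
exists a; first by have := sE a; rewrite eqxx => /andP[].
by move=> b bv; have := sE b; rewrite bv.
Qed.

Lemma prefix_eq_size (T : eqType) (s t : seq T) : size s = size t -> prefix s t = (s == t).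
Proof.
move=> st; apply/idP/eqP => [/prefixP[u ut]|->]; last exact: prefix_refl.
move: st; rewrite ut size_cat -{1}(addn0 (size s)) => /addnI/esym/size0nil ->.
by rewrite cats0.
Qed.

Lemma nbin_single U v n a : v \in rwords k n -> a \in ext v ->
  {in ext v, forall b, U (rcons v b) = (b == a)} ->
  (forall v' b, v' \in rwords k n -> v' != v -> b \in ext v' -> U (rcons v' b) = false) ->
  half_tree n.+1 U.
Proof.
move=> rv av Uv Uv'; exists (rcons v a), false; split.
- by move: av; rewrite mem_ext.
- by rewrite -size_eq0 size_rcons.
- by rewrite size_rcons (size_rwords rv).
move=> p /rwords_rconsP[v' [b [rv' bv' ->]]] /=.
rewrite prefix_eq_size ?size_rcons ?(size_rwords rv) ?(size_rwords rv') //.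
rewrite eqseq_rcons eq_sym; have [e|neq] := eqVneq v' v; last exact: Uv'.
by rewrite e in bv' *; rewrite Uv // eq_sym.
Qed.

Definition fill_in n v U : seq (letter k) -> bool := fun p => (take n p == v) || U p.
Definition fill_out n v U : seq (letter k) -> bool := fun p => (take n p != v) && U p.

Lemma fill_outC n v U : fill_out n v (predC U) =1 predC (fill_in n v U).
Proof. by move=> p; rewrite /fill_out /fill_in /= negb_or. Qed.

Lemma take_rcons_rwords n v a : v \in rwords k n -> take n (rcons v a) = v.
Proof. by move=> /size_rwords <-; rewrite -cats1 take_size_cat. Qed.

Lemma nbin_fill_in n v U x : x \in rwords k n ->
  nbin (fill_in n v U) x = if x == v then size (ext x) else nbin U x.
Proof.
move=> rx; rewrite -sum1_size /nbin.
case: ifP => xv; apply: eq_bigr => a _;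
  by rewrite /fill_in take_rcons_rwords // xv.
Qed.

Lemma nbin_fill_out n v U x : x \in rwords k n ->
  nbin (fill_out n v U) x = if x == v then 0 else nbin U x.
Proof.
move=> rx; rewrite /nbin.
by case: ifP => xv; [apply: big1 => a _|apply: eq_bigr => a _];
  rewrite /fill_out take_rcons_rwords // xv.
Qed.

Lemma has_nbin n U : has U (rwords k n.+1) = has (fun v => 0 < nbin U v) (rwords k n).
Proof.
apply/hasP/hasP => [[p /rwords_rconsP[v [a [rv av ->]]] Up]|[v rv]].
  exists v => //; rewrite lt0n; apply: contraTneq Up => /nbin0P -> //.
rewrite lt0n sum_nat_seq_neq0 => /hasP[a av /=]; rewrite eqb0 negbK => Ua.
by exists (rcons v a) => //; apply/rwords_rconsP; exists v, a.
Qed.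

(** [A] is the weight from [U] off [v] into [v], [B] the weight from [v] to the complement off [v],
    and [R] the part not involving [v]. All three stay the same when only the children of [v] are
    changed, so the three costs can be compared. *)
Lemma cost_fill n U v : v \in rwords k n.+1 ->
  exists A B R, [/\ A + B = q ^ (2 * n.+1),
    cost n.+2 U = nbin U v * (q - nbin U v) * q ^ (2 * n.+1)
                  + nbin U v * B + (q - nbin U v) * A + R,
    cost n.+2 (fill_in n.+1 v U) = q * B + R,
    cost n.+2 (fill_out n.+1 v U) = q * A + R &
    ~~ has (fill_out n.+1 v U) (rwords k n.+2) -> A = 0 /\ R = 0].
Proof.
move=> rv; pose r := rwords k n.+1; pose j := nbin U.
pose B := \sum_(y <- r | y != v) (q - j y) * lcp_ker v y.
pose A := \sum_(x <- r | x != v) j x * lcp_ker x v.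
pose R := \sum_(x <- r | x != v) \sum_(y <- r | y != v) j x * (q - j y) * lcp_ker x y.
have split j' : (forall x, x \in r -> x != v -> j' x = j x) ->
    wcost r lcp_ker q j' = j' v * (q - j' v) * q ^ (2 * n.+1) + j' v * B + (q - j' v) * A + R.
  move=> j'E; rewrite (wcost_split _ _ (rwords_uniq _ _) _ rv) (lcp_kerxx rv).
  congr (_ + _ * _ + _ * _ + _).
  - by rewrite big_seq_cond [RHS]big_seq_cond; apply: eq_bigr => y /andP[ry yv]; rewrite j'E.
  - by rewrite big_seq_cond [RHS]big_seq_cond; apply: eq_bigr => y /andP[ry yv]; rewrite j'E.
  rewrite big_seq_cond [RHS]big_seq_cond; apply: eq_bigr => x /andP[rx xv].
  rewrite big_seq_cond [RHS]big_seq_cond; apply: eq_bigr => y /andP[ry yv].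
  by rewrite !j'E.
exists A, B, R; split.
- rewrite -big_split /= big_seq_cond (eq_bigr (fun y => q * lcp_ker v y)); last first.
    move=> y /andP[ry _]; rewrite (lcp_kerC y) -mulnDl subnKC //.
    by rewrite -(size_ext_rwords ry) nbin_le.
  by rewrite -big_seq_cond -big_distrr lcp_ker_sum //= -expnS; congr (_ ^ _); lia.
- by rewrite cost_wcost (split (nbin U)).
- rewrite cost_wcost split; last by move=> x rx /negPf xv; rewrite nbin_fill_in // xv.
  by rewrite nbin_fill_in // eqxx (size_ext_rwords rv) subnn muln0 !mul0n addn0.
- rewrite cost_wcost split; last by move=> x rx /negPf xv; rewrite nbin_fill_out // xv.
  by rewrite nbin_fill_out // eqxx subn0 !mul0n.
rewrite has_nbin => /hasPn j0.
have {}j0 x : x \in r -> x != v -> j x = 0.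
  by move=> rx /negPf xv; have := j0 x rx; rewrite nbin_fill_out // xv lt0n negbK => /eqP.
split; rewrite /A /R big_seq_cond big1 // => x /andP[rx xv]; rewrite j0 //.
by rewrite big1.
Qed.

Lemma q_ge3 : 3 <= q. Proof. rewrite /q; lia. Qed.

(* [cost] is concave in the number of children of a vertex [v] lying in [U]. When
   some but not all children of [v] lie in [U], putting all of them in or taking
   all of them out thus lowers the cost, by at least [q ^ (2 * n.+1)] for a
   suitable choice of the two unless [U] or its complement is a single word. When
   there is no such [v], the set [U] comes from the previous level. *)
Lemma isoperimetry n U :
  has U (rwords k n.+1) -> has (predC U) (rwords k n.+1) ->
  q ^ (2 * n).+1 <= cost n.+1 U /\
  (q ^ (2 * n).+1 + q ^ (2 * n) <= cost n.+1 U \/ half_tree n.+1 U).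
Proof.
elim: n U => [|n IHn] U.
  have r0 : [::] \in rwords k 0 by [].
  rewrite cost_rec !has_nbin /rwords !big_seq1 /= !orbF nbinCE size_ext_nil.
  rewrite /lcp_ker muln0 expn0 muln1 expn1; set s := nbin _ _ => s0 sk.
  have [s1|s1] := eqVneq s 1.
    split; first by rewrite s1 /q; lia.
    right; have [a av Ua] := nbin1P s1.
    apply: (nbin_single r0 av Ua) => v' b; rewrite /rwords inE => /eqP ->.
    by rewrite eqxx.
  have [s1'|s1'] := eqVneq (2 * k - s) 1.
    split; first by rewrite s1' /q; lia.
    right; apply: half_treeC.
    have [|a av Ua] := @nbin1P (predC U) [::]; first by rewrite nbinCE size_ext_nil.
    apply: (nbin_single r0 av Ua) => v' b; rewrite /rwords inE => /eqP ->.
    by rewrite eqxx.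
  have [|k2s] := leqP (2 * k) s; first by lia.
  have [d kE] : exists d, 2 * k = s + d.+2 by exists (2 * k - s).-2; lia.
  have [e sE] : exists e, s = e.+2 by exists s.-2; lia.
  have := letter_cut_gain e d.
  have -> : q = e.+2 + d.+1 by rewrite /q kE sE; lia.
  have -> : 2 * k - s = d.+2 by rewrite kE addKn.
  by rewrite sE; split; [|left]; lia.
(* Filling keeps the level but lowers the cost, hence an inner induction on the cost. *)
have [m] := ubnP (cost n.+2 U); elim: m U => // m IHm U Um hU hCU.
have [allc|] := boolP (all (fun v => (nbin U v == 0) || (nbin U v == q)) (rwords k n.+1)).
  pose U0 v := nbin U v == q.
  have UE v a : v \in rwords k n.+1 -> a \in ext v -> U (rcons v a) = U0 v.
    move=> rv av; rewrite /U0; have [jq|jq] := eqVneq.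
      by rewrite (nbin_fullP _ av) // jq (size_ext_rwords rv).
    have := allP allc _ rv; rewrite (negPf jq) orbF => /eqP j0.
    by rewrite (nbin0P j0).
  have jE v : v \in rwords k n.+1 -> nbin U v = q * U0 v.
    move=> rv; rewrite /nbin -(size_ext_rwords rv) big_seq (eq_bigr (fun=> U0 v : nat)).
      by rewrite -big_seq big_const_seq iter_addn_0 count_predT mulnC.
    by move=> a av; rewrite UE.
  (* Each pair of parents on opposite sides has [q ^ 2] pairs of children, all of the same
     weight. *)
  have costE : cost n.+2 U = q ^ 2 * cost n.+1 U0.
    rewrite cost_wcost /wcost /cost big_distrr; apply: eq_big_seq => v rv /=.
    rewrite big_distrr; apply: eq_big_seq => v' rv' /=; rewrite !jE //.
    by case: (U0 v); case: (U0 v'); rewrite ?muln0 ?mul0n ?muln1 ?subnn ?subn0 ?muln0 ?mul0n // mul1n.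
  have [||cU0 cU0'] := IHn U0.
  - have [p /rwords_rconsP[v [a [rv av ->]]] Up] := hasP hU.
    by apply/hasP; exists v => //; rewrite -(UE v a).
  - have [p /rwords_rconsP[v [a [rv av ->]]] Up] := hasP hCU.
    by apply/hasP; exists v => //=; rewrite -(UE v a).
  have -> : 2 * n.+1 = 2 + 2 * n by lia.
  rewrite -addnS (expnD q 2 (2 * n).+1) (expnD q 2 (2 * n)) -mulnDr costE; split.
    by rewrite leq_mul2l cU0 orbT.
  case: cU0' => [cU0'|[u [c [ru u0 un Uu]]]].
    by left; rewrite leq_mul2l cU0' orbT.
  right; exists u, c; split=> //; first exact: leqW.
  move=> p /rwords_rconsP[v [a [rv av ->]]]; rewrite UE // Uu // !prefixE.
  by rewrite -cats1 takel_cat // (size_rwords rv).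
move=> /allPn[v rv]; rewrite negb_or => /andP[j0 jq].
have jlt : nbin U v < q.
  by rewrite ltn_neqAle jq -(size_ext_rwords rv) nbin_le.
pose U1 := fill_in n.+1 v U; pose U0 := fill_out n.+1 v U.
have W_gt0 : 0 < q ^ (2 * n.+1) by rewrite expn_gt0 q_gt0.
(* The remaining case, [U0] nonempty and [U1] everything, becomes the first alternative on passing
   to the complement, which exchanges the two fillings. *)
wlog hU0 : U Um hU hCU j0 jq jlt @U1 @U0 / ~~ has U0 (rwords k n.+2) \/
   has U0 (rwords k n.+2) /\ has (predC U1) (rwords k n.+2).
  move=> wl; have [hU0|hU0] := boolP (has U0 (rwords k n.+2)); last by apply: (wl U) => //; left.
  have [hU1|hU1] := boolP (has (predC U1) (rwords k n.+2)); first by apply: (wl U) => //; right.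
  rewrite -costC; suff : q ^ (2 * n.+1).+1 <= cost n.+2 (predC U) /\
    (q ^ (2 * n.+1).+1 + q ^ (2 * n.+1) <= cost n.+2 (predC U) \/ half_tree n.+2 (predC U)).
    by move=> [? [?|/half_treeC ?]]; split=> //; [left|right].
  apply: wl; rewrite ?costC ?nbinCE ?(size_ext_rwords rv) //.
  - by have : has (predC (predC U)) (rwords k n.+2) by under eq_has do rewrite /= negbK.
  - by lia.
  - by lia.
  - by lia.
  - by left; rewrite (eq_has (@fill_outC _ _ _)).
have [A [B [R [AB cU cU1 cU0 hAR]]]] := cost_fill U rv.
rewrite -/U1 in cU1; rewrite -/U0 in cU0 hAR.
have [d qE] : exists d, q = nbin U v + d.+1 by exists (q - nbin U v).-1; lia.
have hU1 : has U1 (rwords k n.+2).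
  by have [p rp Up] := hasP hU; apply/hasP; exists p => //; rewrite /U1 /fill_in Up orbT.
(* With at least two children in [U] the vertex is filled in; a single child is taken out, unless it
   is all of [U]. *)
have [[e jE]|j1] : (exists e, nbin U v = e.+2) \/ nbin U v = 1.
- by case: (nbin U v) j0 => [|[|e]] // _; [right|left; exists e].
- have gain : cost n.+2 U1 + q ^ (2 * n.+1) <= cost n.+2 U.
    rewrite cU cU1 -AB; rewrite jE in qE *; rewrite qE addKn; exact: fill_in_gain.
  have [||c1 _] := IHm U1 _ hU1; first by lia.
    case: hU0 => [/hAR [A0 R0]|[_ //]].
    (* When [U] lives under [v] alone, [A] and [R] vanish and [cost n.+2 U1] is [q * B], which is
       positive; the full sphere would have cost zero. *)
    apply/negPn/negP => /hasPn U1full; suff : cost n.+2 U1 = 0.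
      rewrite cU1 R0 addn0; move: AB W_gt0 q_gt0; rewrite A0 add0n => <- B0 q0.
      by move/eqP; rewrite muln_eq0 (gtn_eqF B0) (gtn_eqF q0).
    rewrite /cost big1_seq // => p _; rewrite big1_seq // => p' /andP[_ rp'].
    by have := U1full _ rp'; rewrite /= negbK => ->; rewrite andbF.
  by split; [|left]; lia.
case: hU0 => [hU0|[hU0 hU1']].
  have [A0 R0] := hAR hU0; split.
    rewrite cU A0 R0 j1 expnS -AB A0; move: q_ge3; case: (q) => // q' _.
    rewrite muln0 subSS subn0 !mul1n !addn0 !add0n; lia.
  right; have [a av Ua] := nbin1P j1.
  apply: (nbin_single rv av Ua) => v' b rv' v'v bv'.
  have /hasPn/(_ (rcons v' b)) := hU0; rewrite /U0 /fill_out take_rcons_rwords // v'v /=.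
  by move=> /(_ _)/negPf; apply; apply/rwords_rconsP; exists v', b.
have gain : cost n.+2 U0 + q ^ (2 * n.+1) <= cost n.+2 U.
  by rewrite cU cU0 -AB j1; move: q_ge3; case: (q) => [|[|[|q']]] // _; exact: fill_out_gain.
have [||c1 _] := IHm U0 _ hU0; first by lia.
  have [p rp Up] := hasP hCU; apply/hasP; exists p => //=.
  by rewrite /U0 /fill_out negb_and; apply/orP; right.
by split; [|left]; lia.
Qed.

End Isoperimetry.

(** * Frequencies of words along a random end *)

Section Averages.
Local Open Scope ring_scope.
Variables (R : realType) (k : nat).
Hypothesis hk : (2 <= k)%N.
Implicit Types (a b : letter k) (u v : seq (letter k)) (F : seq (letter k) -> R).

Let q : R := 2 * k%:R - 1.

Lemma natr_q : ((2 * k).-1)%:R = q.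
Proof.
have -> : (2 * k).-1 = (2 * k - 1)%N by lia.
rewrite natrB ?natrM //; lia.
Qed.

Lemma qr_ge3 : 3 <= q.
Proof. rewrite -natr_q ler_nat; lia. Qed.

(** The cylinder mass for words of length [n > 0]. At [0] the formula does not give total mass one,
    hence the levels [n.+1] below. *)
Definition mass n : R := (2 * k%:R * q ^+ n.-1)^-1.

Definition avg n F : R := mass n * \sum_(u <- rwords k n) F u.

Lemma mass_gt0 n : 0 < mass n.
Proof.
have q0 : 0 < q by have := qr_ge3; lra.
by rewrite invr_gt0 mulr_gt0 ?exprn_gt0 // mulr_gt0 ?ltr0n //; lia.
Qed.

Lemma massS n : mass n.+2 = mass n.+1 / q.
Proof. by rewrite /mass /= exprSr mulrA [in LHS]invfM. Qed.

Lemma avgS n F : avg n.+2 F =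
  mass n.+1 * \sum_(u <- rwords k n.+1) q^-1 * \sum_(b <- ext u) F (rcons u b).
Proof. by rewrite /avg big_rwordsS massS -mulrA big_distrr. Qed.

Lemma sum_ext_const n u (c : R) : u \in rwords k n.+1 ->
  \sum_(b <- ext u) c = q * c.
Proof.
by move=> ru; rewrite big_const_seq count_predT (size_ext_rwords ru) iter_addr_0 -natr_q mulr_natl.
Qed.

Lemma avg1 n : avg n.+1 (fun=> 1) = 1.
Proof.
have qn0 : q != 0 by have := qr_ge3; apply: contraTneq => ->; rewrite -ltNge ltr0n.
elim: n => [|n IHn]; last first.
  rewrite avgS -[RHS]IHn /avg; congr (_ * _); apply: eq_big_seq => u ru.
  by rewrite (sum_ext_const _ ru) mulr1 mulVf.
rewrite /avg big_rwordsS /rwords big_seq1 big_const_seq count_predT (size_ext_nil).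
rewrite iter_addr_0 /mass expr0 mulr1 natrM mulVf // mulf_neq0 ?pnatr_eq0 //; lia.
Qed.

Section Excess.
Variables (v : seq (letter k)) (a : letter k).
Hypotheses (v0 : v != [::]) (va : reduced (rcons v a)).

(** A martingale difference: after an occurrence of [v], each of the [q] admissible letters, [a]
    among them, has conditional probability [1 / q]. *)
Definition excess j u : R :=
  (take (size v).+1 (drop j u) == rcons v a)%:R - (take (size v) (drop j u) == v)%:R / q.

Definition excess_sum n u : R := \sum_(j < n) excess j u.

Lemma excess_rcons j u b : (j + size v < size u)%N -> excess j (rcons u b) = excess j u.
Proof.
move=> ju; rewrite /excess -cats1 drop_cat (leq_ltn_trans (leq_addr _ _) ju).
by rewrite !takel_cat ?size_drop //; lia.
Qed.

Lemma excess_sum_rcons n u b : (n + size v <= size u)%N ->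
  excess_sum n (rcons u b) = excess_sum n u.
Proof.
move=> nu; apply: eq_bigr => -[j jn] _ /=; apply: excess_rcons.
by apply: leq_trans nu; rewrite ltn_add2r.
Qed.

Lemma excess_last n u b : size u = (n + size v)%N ->
  excess n (rcons u b) = (drop n u == v)%:R * ((b == a)%:R - q^-1).
Proof.
move=> su; rewrite /excess drop_rcons; last by rewrite su leq_addr.
have sd : size (drop n u) = size v by rewrite size_drop su addKn.
rewrite take_oversize ?size_rcons ?sd // eqseq_rcons.
rewrite -cats1 takel_cat ?sd // take_oversize ?sd //.
by case: eqP => _; rewrite /= ?mul1r ?mul0r ?subr0.
Qed.

Lemma excess_bound j u : `|excess j u| <= 1.
Proof.
have := qr_ge3 => hq; have q0 : 0 < q by lra.
have : q^-1 <= 1 by rewrite invf_le1 //; lra.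
have : 0 < q^-1 by rewrite invr_gt0.
rewrite /excess ler_norml; case: eqP => _; case: eqP => _ /=; move=> ? ?; apply/andP; split; lra.
Qed.

(* Given the letters before it, the last letter makes an excess of mean zero: the
   excesses are orthogonal. *)
Lemma avg_excess_sum_sqr n : avg (n + size v) (fun u => excess_sum n u ^+ 2) <= n%:R.
Proof.
have := qr_ge3 => hq; have q0 : 0 < q by lra.
have qn0 : q != 0 by rewrite gt_eqF.
have [m vm] : exists m, size v = m.+1 by case: (v) v0 => // ? s _; exists (size s).
elim: n => [|n IHn].
  by rewrite /avg big1 ?mulr0 // => u _; rewrite /excess_sum big_ord0 expr0n.
apply: (@le_trans _ _ (avg (n + size v) (fun u => excess_sum n u ^+ 2 + 1))); last first.
  rewrite /avg big_split /= mulrDr -natr1 lerD //.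
  by rewrite -/(avg _ (fun=> 1)) vm addnS avg1.
rewrite vm addSn !addnS avgS ler_wpM2l //; first by rewrite ltW ?mass_gt0.
rewrite big_seq [leRHS]big_seq; apply: ler_sum => u ru.
have su := size_rwords ru.
have su' : size u = (n + size v)%N by rewrite vm addnS.
rewrite [leLHS]mulrC ler_pdivrMr //.
rewrite (eq_bigr (fun b => excess_sum n u ^+ 2 + (2 * excess_sum n u * excess n (rcons u b)
     + excess n (rcons u b) ^+ 2))); last first.
  move=> b _; rewrite /excess_sum big_ord_recr /= -!/(excess_sum _ _).
  rewrite -/(excess_sum n (rcons u b)) excess_sum_rcons ?su' //; ring.
rewrite !big_split /= (sum_ext_const _ ru) -big_distrr /= [leRHS]mulrDl mul1r [q * _]mulrC lerD2l.
have -> : \sum_(b <- ext u) excess n (rcons u b) = 0.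
  under eq_bigr do rewrite excess_last //.
  rewrite -big_distrr /=; case: eqP => [dv|_]; last by rewrite mul0r.
  rewrite big_split /= (sum_ext_const _ ru) mulrN mulfV // mul1r.
  have au : a \in ext u.
    rewrite mem_ext -(cat_take_drop n u) dv rcons_cat -cats1 reduced_overlap //.
      by have := ru; rewrite mem_rwords -dv cat_take_drop => /andP[].
    by rewrite cats1.
  rewrite (bigD1_seq a) ?ext_uniq //= eqxx big1 ?addr0 ?subrr // => b ba.
  by rewrite (negPf ba).
rewrite mulr0 add0r; apply: (@le_trans _ _ (\sum_(b <- ext u) 1)).
  by apply: ler_sum => b _; rewrite -real_normK ?num_real // expr_le1 // excess_bound.
by rewrite (sum_ext_const _ ru) mulr1.
Qed.

End Excess.
End Averages.

(** * Functions of finitely many letters of a random end *)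

Section PrefixLaw.
Local Open Scope classical_set_scope.
Local Open Scope ring_scope.
Variables (R : realType) (k : nat) (hk : (2 <= k)%N).
Variable mu : probability (boundary_borel hk) R.
Hypothesis hmu : is_uniform mu.
Implicit Types (a b : letter k) (u v : seq (letter k)) (F : seq (letter k) -> R).

Definition lw (w : set_type (@inf_reduced k)) : nat -> letter k := set_val w.

Lemma open_coord (i : nat) b : open [set w : words k | w i = b].
Proof.
have -> : [set w : words k | w i = b] =
    (proj i : words k -> discrete_topology (letter k)) @^-1` [set b] by [].
apply: open_comp; last exact: discrete_open.
by move=> w _; exact: proj_continuous.
Qed.

Lemma open_prefix n u : open [set w : words k | mkseq w n = u].
Proof.
elim: n u => [|n IHn] u.
  have [->|u0] := eqVneq u [::].
    by rewrite (_ : [set _ | _] = setT); [exact: openT|apply/seteqP; split].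
  rewrite (_ : [set _ | _] = set0); [exact: open0|apply/seteqP; split => // w /= e].
  by move: u0; rewrite -e.
case: (lastP u) => [|{}u b].
  rewrite (_ : [set _ | _] = set0); [exact: open0|apply/seteqP; split => // w /= e].
rewrite (_ : [set _ | _] = [set w : words k | mkseq w n = u] `&` [set w | w n = b]).
  by apply: openI; [exact: IHn|exact: open_coord].
apply/seteqP; split => w /=; rewrite mkseqS.
  by move=> /rcons_inj[].
by move=> [-> ->].
Qed.

Definition prefix_event n u : set (boundary_borel hk) := [set w | mkseq (lw w) n = u].

Lemma measurable_prefix_event n u : measurable (prefix_event n u).
Proof.
apply: sub_sigma_algebra.
have -> : prefix_event n u = (set_val : boundary hk -> words k) @^-1` [set w | mkseq w n = u] by [].
apply: open_comp; last exact: open_prefix.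
by move=> w _; exact: initial_continuous.
Qed.

Lemma mu_prefix_event n u : u \in rwords k n.+1 -> mu (prefix_event n.+1 u) = (mass R k n.+1)%:E.
Proof.
rewrite mem_rwords => /andP[ru /eqP su].
have -> : prefix_event n.+1 u = cylinder (hk := hk) (fgw u).
  apply/seteqP; split => w; rewrite /cylinder /prefix_event /= wlen_fgw // su.
    by move=> e; apply: val_inj; rewrite val_fgw.
  by move=> /(congr1 val); rewrite val_fgw.
rewrite hmu ?wlen_fgw ?su //.
by rewrite -wlen_eq0 wlen_fgw // su.
Qed.

Lemma prefix_mem (w : boundary hk) n : mkseq (lw w) n \in rwords k n.
Proof. by rewrite mem_rwords size_mkseq eqxx reduced_prefix. Qed.

Lemma prefix_funE F n (w : boundary_borel hk) :
  F (mkseq (lw w) n) = \sum_(u <- rwords k n) F u * \1_(prefix_event n u) w.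
Proof.
rewrite (bigD1_seq _ (prefix_mem w n) (rwords_uniq _ _)) /= indicE mem_set //= mulr1.
rewrite big1 ?addr0 // => u /negPf uw; rewrite indicE memNset ?mulr0 //=.
by rewrite /prefix_event /= => e; rewrite e eqxx in uw.
Qed.

Lemma measurable_prefix_fun F n :
  measurable_fun setT (fun w : boundary_borel hk => F (mkseq (lw w) n)).
Proof.
under eq_fun do rewrite prefix_funE.
apply: measurable_sum => u; apply: measurable_funM; first exact: measurable_cst.
by apply: measurable_indic; exact: measurable_prefix_event.
Qed.

Lemma integral_prefix F n : (forall u, 0 <= F u) ->
  (\int[mu]_w (F (mkseq (lw w) n.+1))%:E = (avg n.+1 F)%:E)%E.
Proof.
move=> F0; under eq_integral do rewrite prefix_funE -sumEFin.
rewrite ge0_integral_sum //=; first last.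
- by move=> u w _; rewrite lee_fin mulr_ge0.
- move=> u; apply/measurable_EFinP/measurable_funM; first exact: measurable_cst.
  by apply: measurable_indic; exact: measurable_prefix_event.
rewrite /avg big_distrr -sumEFin; apply: eq_big_seq => u ru /=.
under eq_integral do rewrite EFinM.
rewrite ge0_integralZl_EFin //=; first last.
- by apply/measurable_EFinP/measurable_indic; exact: measurable_prefix_event.
rewrite integral_indic //; last exact: measurable_prefix_event.
by rewrite setIT [X in (_ * X)%E](mu_prefix_event ru) -EFinM mulrC.
Qed.

End PrefixLaw.

Lemma between_squares n : (0 < n)%N -> exists m, (m.+1 ^ 2 <= n < m.+2 ^ 2)%N.
Proof.
elim: n => // -[|n] IHn _; first by exists 0%N.
have [//|m /andP[mn nm]] := IHn.
have [h|h] := leqP (m.+2 ^ 2) n.+2; last by exists m; rewrite h andbT; lia.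
exists m.+1; rewrite h /=; apply: leq_ltn_trans nm _; rewrite ltn_exp2r //.
Qed.

(** * From the squares to all integers *)

Section Interpolation.
Local Open Scope classical_set_scope.
Local Open Scope ring_scope.
Variable R : realType.
Implicit Types s : nat -> R.

Lemma lipschitz_seq s m n : (forall n, `|s n.+1 - s n| <= 1) -> (m <= n)%N ->
  `|s n - s m| <= (n - m)%:R.
Proof.
move=> s1; elim: n => [|n IHn] mn.
  by move: mn; rewrite leqn0 => /eqP ->; rewrite subrr normr0.
move: mn; rewrite leq_eqVlt => /predU1P[->|mn]; first by rewrite subrr normr0.
rewrite subSn // -natr1 (le_trans (ler_distD (s n) _ _)) // addrC lerD //.
exact: IHn.
Qed.

(** Between consecutive squares around [n] the sequence moves by [O(sqrt n)], which is negligible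
    against [n]. *)
Lemma cvg_squares s : s 0%N = 0 -> (forall n, `|s n.+1 - s n| <= 1) ->
  (fun n => s (n.+1 ^ 2)%N ^+ 2 / n.+1%:R ^+ 4) @ \oo --> (0 : R) ->
  (fun n => s n / n%:R) @ \oo --> (0 : R).
Proof.
move=> s0 s1 cs; apply/cvgr0Pnorm_lt => e e0.
have e2 : 0 < (e / 2) ^+ 2 by rewrite exprn_gt0 // divr_gt0.
have /cvgr0Pnorm_lt/(_ _ e2) [M _ hM] := cs.
(* The distance from [m.+1 ^ 2] to [n] is at most [2 * m.+1 + 1], hence at most [3 * m.+1]. *)
have [L hL] : exists L, forall m, (L <= m)%N -> 3 / m.+1%:R < e / 2.
  exists (Num.truncn (6 / e)) => m Lm.
  rewrite ltr_pdivrMr ?ltr0n //.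
  have := truncnS_gt (6 / e) => h.
  have : (6 / e : R) < m.+1%:R by apply: lt_le_trans h _; rewrite ler_nat.
  by rewrite ltr_pdivrMr // => ?; lra.
exists ((maxn M L).+2 ^ 2)%N => // n /= Nn.
have [|m /andP[mn nm]] := @between_squares n; first by apply: leq_trans Nn.
have /andP[Mm Lm] : (M <= m)%N && (L <= m)%N.
  rewrite -geq_max; suff : ((maxn M L).+2 < m.+2)%N by lia.
  by rewrite -(ltn_exp2r _ _ (isT : 0 < 2)%N) (leq_ltn_trans Nn).
have m0 : 0 < m.+1%:R :> R by rewrite ltr0n.
have n0 : 0 < n%:R :> R by rewrite ltr0n (leq_trans _ mn).
have sm : `|s (m.+1 ^ 2)%N| < e / 2 * m.+1%:R ^+ 2.
  have := hM m Mm; rewrite ger0_norm ?divr_ge0 ?sqr_ge0 ?exprn_ge0 //.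
  rewrite ltr_pdivrMr ?exprn_gt0 // -[4%N]/(2 * 2)%N exprM -exprMn.
  by rewrite -[_ ^+ 2]real_normK ?num_real // ltr_pXn2r ?nnegrE // ?mulr_ge0 ?divr_ge0 ?exprn_ge0 // ltW.
have sn : `|s n| <= `|s (m.+1 ^ 2)%N| + (2 * m.+1%:R + 1).
  rewrite -[s n](subrK (s (m.+1 ^ 2)%N)) addrC (le_trans (ler_normD _ _)) // lerD2l.
  rewrite (le_trans (lipschitz_seq s1 mn)) // -[2]/(2%:R) -natrM natr1 ler_nat.
  by move: nm mn; rewrite !expnS !expn0; lia.
have mn' : m.+1%:R ^+ 2 <= n%:R :> R by rewrite -natrX ler_nat.
rewrite normrM normfV (gtr0_norm n0) ltr_pdivrMr //.
have := hL m Lm; rewrite ltr_pdivrMr // => h3.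
have m1 : 1 <= m.+1%:R :> R by rewrite ler1n.
nra.
Qed.

End Interpolation.

Section Series.
Local Open Scope classical_set_scope.
Local Open Scope ring_scope.
Variable R : realType.

(** Telescoping, as [1 / (x + 1)^2 <= 1 / x - 1 / (x + 1)]; at [n = 0] the convention is that the
    inverse of zero is zero. *)
Lemma sum_inv_sqr n : \sum_(0 <= i < n) (i.+1%:R ^+ 2)^-1 <= 2 - n%:R^-1 :> R.
Proof.
elim: n => [|n IHn]; first by rewrite big_nil invr0; lra.
case: n IHn => [_|n IHn]; first by rewrite big_nat1 expr1n invr1; lra.
rewrite big_nat_recr //=; apply: (le_trans (lerD IHn (lexx _))).
have : 0 < n.+1%:R :> R by rewrite ltr0n.
rewrite -[n.+2%:R]natr1; set x : R := n.+1%:R => x0.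
have x1 : 0 < x + 1 by lra.
suff : 0 <= x^-1 - (x + 1)^-1 - ((x + 1) ^+ 2)^-1.
  by move: x^-1 (x + 1)^-1 ((x + 1) ^+ 2)^-1 => y z t; lra.
have -> : x^-1 - (x + 1)^-1 - ((x + 1) ^+ 2)^-1 = (x * (x + 1) ^+ 2)^-1.
  by field; rewrite !gt_eqF.
by rewrite invr_ge0 mulr_ge0 ?exprn_ge0 // ltW.
Qed.

Lemma cvg0_of_nneseries (r : nat -> R) : (forall n, 0 <= r n) ->
  ((\sum_(n <oo) (r n)%:E)%E < +oo)%E -> r @ \oo --> (0 : R).
Proof.
move=> r0 rfin; apply: cvg_series_cvg_0.
apply: nondecreasing_is_cvgn.
  by apply: nondecreasing_series => n _ _.
have l0 : (0 <= \sum_(n <oo) (r n)%:E)%E by apply: nneseries_ge0 => n _ _; rewrite lee_fin.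
exists (fine (\sum_(n <oo) (r n)%:E)%E) => _ [n _ <-].
rewrite -lee_fin fineK ?ge0_fin_numE // -sumEFin.
by apply: nneseries_lim_ge => i _ _; rewrite lee_fin.
Qed.

Lemma cvg_ext (f g : nat -> R) (l : R) : f =1 g -> f @ \oo --> l -> g @ \oo --> l.
Proof. by move=> /funext ->. Qed.

Lemma cvg_sum (I : Type) (s : seq I) (P : pred I) (F : I -> nat -> R) (l : I -> R) :
  (forall i, P i -> F i @ \oo --> l i) ->
  (fun n => \sum_(i <- s | P i) F i n) @ \oo --> \sum_(i <- s | P i) l i.
Proof.
move=> cF; elim: s => [|i s IHs].
  by under eq_cvg do rewrite big_nil; rewrite big_nil; exact: cvg_cst.
under eq_cvg do rewrite big_cons; rewrite big_cons.
by have [Pi|//] := boolP (P i); apply: cvgD => //; exact: cF.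
Qed.

Lemma cvg_sum_seq (I : eqType) (s : seq I) (F : I -> nat -> R) (l : I -> R) :
  {in s, forall i, F i @ \oo --> l i} ->
  (fun n => \sum_(i <- s) F i n) @ \oo --> \sum_(i <- s) l i.
Proof.
move=> cF; have := @cvg_sum I s (mem s) F l cF; rewrite -big_seq.
by move/cvg_ext; apply => n; rewrite -big_seq.
Qed.

End Series.

Section Occurrences.
Local Open Scope classical_set_scope.
Local Open Scope ring_scope.
Variable k : nat.
Implicit Types (w : nat -> letter k) (v : seq (letter k)).

Definition window w j m := mkseq (fun i => w (j + i)%N) m.

Definition occ v w n : nat := \sum_(j < n) (window w j (size v) == v).

Lemma take_drop_prefix w j m n : (j + m <= n)%N -> take m (drop j (mkseq w n)) = window w j m.
Proof.
move=> jmn; have sE : size (take m (drop j (mkseq w n))) = m.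
  by rewrite size_takel // size_drop size_mkseq leq_subRL ?(leq_trans _ jmn) ?leq_addr.
apply: (@eq_from_nth _ (w 0%N)); first by rewrite sE size_mkseq.
move=> i; rewrite sE => im.
rewrite nth_take // nth_drop !nth_mkseq //.
by rewrite (leq_trans _ jmn) // ltn_add2l.
Qed.

Lemma window_rcons w j m : window w j m.+1 = rcons (window w j m) (w (j + m)%N).
Proof. by rewrite /window mkseqS. Qed.

Lemma occ0 v w : occ v w 0 = 0%N.
Proof. by rewrite /occ big_ord0. Qed.

Lemma occS v w n : occ v w n.+1 = (occ v w n + (window w n (size v) == v))%N.
Proof. by rewrite /occ big_ord_recr. Qed.

End Occurrences.

(** * The strong law for occurrences of words *)

Section StrongLaw.
Local Open Scope classical_set_scope.
Local Open Scope ring_scope.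
Variables (R : realType) (k : nat) (hk : (2 <= k)%N).
Variable mu : probability (boundary_borel hk) R.
Hypothesis hmu : is_uniform mu.
Implicit Types (a b x y : letter k) (u v : seq (letter k)) (w : nat -> letter k).

Let q : R := 2 * k%:R - 1.

Lemma ae_imply (P Q : boundary_borel hk -> Prop) : (forall z, P z -> Q z) ->
  {ae mu, forall z, P z} -> {ae mu, forall z, Q z}.
Proof. by move=> PQ; apply: filterS. Qed.

Section Excess.
Variables (v : seq (letter k)) (a : letter k).
Hypotheses (v0 : v != [::]) (va : reduced (rcons v a)).

Definition occ_excess w n : R := (occ (rcons v a) w n)%:R - (occ v w n)%:R / q.

Lemma occ_excessE w n N : (n + size v <= N)%N ->
  occ_excess w n = excess_sum R v a n (mkseq w N).
Proof.
move=> nN; rewrite /occ_excess /excess_sum /excess /occ !natr_sum big_distrl /= -sumrB.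
apply: eq_bigr => -[j jn] _ /=; rewrite !take_drop_prefix ?size_rcons //; lia.
Qed.

Lemma occ_excess_lipschitz w n : `|occ_excess w n.+1 - occ_excess w n| <= 1.
Proof.
rewrite !(@occ_excessE w _ (n.+1 + size v)) // /excess_sum big_ord_recr /= addrAC subrr add0r.
exact: excess_bound.
Qed.

(** At time [(n + 1)^2] the normalised square has mean at most [1 / (n + 1)^2], by orthogonality.
    These means are summable, so the sum of the squares is almost everywhere finite and its terms
    tend to zero; [cvg_squares] fills in the other times. *)
Lemma ae_occ_excess : {ae mu, forall w : boundary hk,
  (fun n => occ_excess (lw w) n / n%:R) @ \oo --> (0 : R)}.
Proof.
pose N n := (n.+1 ^ 2 + size v)%N.
pose r n (u : seq (letter k)) : R := excess_sum R v a (n.+1 ^ 2) u ^+ 2 / n.+1%:R ^+ 4.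
pose f n (z : boundary_borel hk) := (r n (mkseq (lw (z : boundary hk)) (N n)))%:E.
have r0 n u : 0 <= r n u by rewrite divr_ge0 ?sqr_ge0 ?exprn_ge0.
have f0 n z : (0 <= f n z)%E by rewrite lee_fin.
have mf n : measurable_fun setT (f n).
  apply/measurable_EFinP; exact: (@measurable_prefix_fun _ _ _ (r n) (N n)).
have intf n : (\int[mu]_z f n z <= ((n.+1%:R ^+ 2)^-1)%:E)%E.
  have NE : N n = (N n).-1.+1 by rewrite /N; case: (v) v0 => // ? s _; rewrite addnS.
  rewrite /f NE integral_prefix // -NE lee_fin /r /avg.
  rewrite -big_distrl /= mulrA -/(avg (N n) (fun u => excess_sum R v a (n.+1 ^ 2) u ^+ 2)).
  rewrite ler_pdivrMr ?exprn_gt0 // (le_trans (avg_excess_sum_sqr _ hk v0 va _)) //.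
  rewrite natrX -[4%N]/(2 + 2)%N exprD mulrA mulVf ?mul1r //.
have intsum : (\int[mu]_z (\sum_(n <oo) f n z) < +oo)%E.
  rewrite integral_nneseries //.
  apply: (@le_lt_trans _ _ 2%:E); last exact: ltry.
  apply: lime_le.
    by apply: is_cvg_nneseries => n _ _; apply: integral_ge0.
  apply: nearW => n; apply: (@le_trans _ _ (\sum_(0 <= i < n) ((i.+1%:R ^+ 2)^-1)%:E)%E).
    by apply: lee_sum => i _; exact: intf.
  rewrite sumEFin lee_fin (le_trans (sum_inv_sqr _ _)) //.
  by rewrite gerBl invr_ge0.
have msum : measurable_fun setT (fun z => \sum_(n <oo) f n z)%E.
  by apply: ge0_emeasurable_sum => // n _.
have /integrable_ae : mu.-integrable setT (fun z => \sum_(n <oo) f n z)%E.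
  apply/integrableP; split => //.
  under eq_integral do rewrite gee0_abs ?nneseries_ge0 //.
  by [].
move=> /(_ measurableT); apply: filterS => w /(_ I) fin.
apply: cvg_squares.
- by rewrite /occ_excess !occ0 mul0r subrr.
- exact: occ_excess_lipschitz.
have : (fun n => r n (mkseq (lw w) (N n))) @ \oo --> (0 : R).
  by apply: cvg0_of_nneseries => //; rewrite ltey_eq fin.
by under eq_cvg do rewrite /r -occ_excessE //.
Qed.

End Excess.

Definition generic (w : nat -> letter k) := forall v, reduced v -> v != [::] ->
  (fun n => (occ v w n)%:R / n%:R) @ \oo --> (mass R k (size v)).

Definition excess_free (w : nat -> letter k) := forall v a, v != [::] -> reduced (rcons v a) ->
  (fun n => occ_excess v a w n / n%:R) @ \oo --> (0 : R).

Lemma ae_excess_free : {ae mu, forall w : boundary hk, excess_free (lw w)}.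
Proof.
have : {ae mu, forall w : boundary hk, forall n,
   if unpickle n is Some va then va.1 != [::] -> reduced (rcons va.1 va.2) ->
  (fun n => occ_excess va.1 va.2 (lw w) n / n%:R) @ \oo --> (0 : R) else True}.
  apply: ae_foralln => n; case: (unpickle n) => [[v a]|]; last exact: aeW.
  have [v0|v0] := boolP (v == [::]); first exact: aeW.
  have [rva|rva] := boolP (reduced (rcons v a)); last exact: aeW.
  by apply: ae_imply (ae_occ_excess v0 rva) => w h _ _.
apply: ae_imply => w h v a; have := h (pickle (v, a)).
by rewrite pickleK.
Qed.

Lemma occ_letter w y n : (forall i, w i.+1 != linv (w i)) ->
  (occ [:: y] w n.+1)%:R =
    (w 0%N == y)%:R + \sum_(x | x != linv y) (occ [:: x; y] w n)%:R :> R.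
Proof.
move=> rw; elim: n => [|n IHn].
  rewrite occS !occ0 add0n big1; last by move=> x _; rewrite occ0.
  by rewrite addr0 /= /window /mkseq /= eqseq_cons andbT.
rewrite occS natrD IHn -addrA; congr (_ + _).
under [RHS]eq_bigr do rewrite occS natrD.
rewrite big_split /=; congr (_ + _).
rewrite /window /mkseq /= !addn0 !eqseq_cons andbT.
have [e|ne] := eqVneq (w n.+1) y.
  rewrite (bigD1 (w n)) /=; last first.
    by have := rw n; rewrite e; apply: contra_neq => ->; rewrite linvK.
  rewrite !eqseq_cons eqxx addn1 e eqxx big1 ?addr0 // => x /andP[_ xn].
  by rewrite eqseq_cons eq_sym (negPf xn).
by rewrite big1 // => x _; rewrite !eqseq_cons addn1 (negPf ne) andbF.
Qed.

Lemma sum_occ_letter w n : (\sum_x (occ [:: x] w n)%:R = n%:R :> R).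
Proof.
elim: n => [|n IHn]; first by rewrite big1 // => x _; rewrite occ0.
under eq_bigr do rewrite occS natrD.
rewrite big_split /= IHn -natr1; congr (_ + _).
rewrite (bigD1 (w n)) //= /window /mkseq /= addn0 eqxx big1 ?addr0 // => x xw.
by rewrite eqseq_cons eq_sym (negPf xw).
Qed.

(** Apart from position zero, an occurrence of [y] follows a letter [x] other than [linv y], and
    [xy] occurs asymptotically [1 / q] times as often as [x]. As letter frequencies sum to one, this
    gives [f(y) = (1 - f(linv y)) / q]. *)
Lemma excess_free_letter w y : (forall i, w i.+1 != linv (w i)) -> excess_free w ->
  (fun n => (occ [:: y] w n)%:R / n%:R + (occ [:: linv y] w n)%:R / n%:R / q) @ \oo
    --> q^-1.
Proof.
move=> rw hw.
have -> : (fun n => (occ [:: y] w n)%:R / n%:R + (occ [:: linv y] w n)%:R / n%:R / q) =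
  (fun n => ((w 0%N == y)%:R - (window w n 1 == [:: y])%:R) / n%:R
    + \sum_(x | x != linv y) (occ_excess [:: x] y w n / n%:R) + (n%:R / n%:R) / q).
  apply/funext => n; rewrite -big_distrl /= /occ_excess sumrB -big_distrl /=.
  have := occ_letter y n rw; rewrite occS natrD.
  have := sum_occ_letter w n; rewrite (bigD1 (linv y)) //=.
  set A := \sum_(x | _) (occ [:: x; y] w n)%:R; set B := \sum_(x | _) _.
  move: (occ [:: y] w n)%:R (occ [:: linv y] w n)%:R (w 0%N == y)%:R
    (window w n 1 == [:: y])%:R => f g d c gB fA.
  have -> : f = d + A - c by rewrite -fA; ring.
  by rewrite -gB; ring.
have n0 : (fun n => n%:R^-1 : R) @ \oo --> (0 : R).
  by rewrite -(cvg_shiftS (fun n => n%:R^-1 : R)); exact: cvg_harmonic.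
have c1 : (fun n => ((w 0%N == y)%:R - (window w n 1 == [:: y])%:R) / n%:R) @ \oo --> (0 : R).
  apply: (@squeeze_cvgr _ _ _ _ (fun n => - n%:R^-1) (fun n => n%:R^-1)) => //; last first.
    by rewrite -oppr0; exact: cvgN.
  near=> n; have : 0 <= n%:R^-1 :> R by rewrite invr_ge0.
  by case: (_ == _); case: (_ == _); rewrite /= ?subrr ?subr0 ?sub0r ?mul1r ?mulN1r ?mul0r; lra.
have c2 : (fun n => \sum_(x | x != linv y) (occ_excess [:: x] y w n / n%:R)) @ \oo --> (0 : R).
  have := @cvg_sum R _ (index_enum _) (fun x => x != linv y)
    (fun x n => occ_excess [:: x] y w n / n%:R) (fun=> 0).
  rewrite [X in (_ -> _ --> X) -> _]big1 //; apply => x xy.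
  apply: hw => //=; rewrite /reduced /= andbT.
  by apply: contra_neq xy => ->; rewrite linvK.
have c3 : (fun n => (n%:R / n%:R) / q : R) @ \oo --> q^-1.
  rewrite -[X in _ --> X]mul1r; apply: cvgMl.
  apply: cvg_near_cst; near=> n; rewrite divff // pnatr_eq0 -lt0n.
  by near: n; exists 1%N.
by rewrite -[X in _ --> X]add0r -[X in _ --> X + _]addr0; apply: cvgD => //; apply: cvgD.
Unshelve. all: by end_near.
Qed.

Lemma excess_free_generic w : (forall i, w i.+1 != linv (w i)) -> excess_free w -> generic w.
Proof.
move=> rw hw v; have q3 := qr_ge3 R hk; rewrite -/q in q3.
elim/last_ind: v => // v a IHv rva _; case: (eqVneq v [::]) => [->|v0].
  have := excess_free_letter a rw hw; have := excess_free_letter (linv a) rw hw.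
  rewrite linvK => ha' ha.
  have cst c : (fun=> c : R) @ \oo --> c by exact: cvg_cst.
  pose f y n : R := (occ [:: y] w n)%:R / n%:R.
  (* The relations for [a] and [linv a] form a linear system of determinant [1 - q^-2]; eliminating
     [linv a] gives the frequency [1 / (q + 1) = 1 / (2k)]. *)
  have : (fun n => (f a n + f (linv a) n / q - (f (linv a) n + f a n / q) * q^-1)
      * (1 - q^-1 ^+ 2)^-1) @ \oo --> (q^-1 - q^-1 * q^-1) * (1 - q^-1 ^+ 2)^-1.
    apply: cvgM; last exact: cst.
    by apply: cvgB; [exact: ha|apply: cvgM; [exact: ha'|exact: cst]].
  rewrite /mass /= expr0 mulr1.
  rewrite (_ : (q^-1 - q^-1 * q^-1) * _ = (2 * k%:R)^-1); last first.
    have -> : 2 * k%:R = q + 1 by rewrite /q subrK.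
    by field; rewrite !gt_eqF //; nra.
  move/cvg_ext; apply => n; rewrite -/(f a n); move: (f a n) (f _ n) => x y.
  by field; apply/andP; split; rewrite ?gt_eqF //; nra.
have rv : reduced v by move: rva; rewrite -cats1 => /reduced_catl.
have hv := IHv rv v0.
have m : (size v).-1.+1 = size v by case: (v) v0.
have cst c : (fun=> c : R) @ \oo --> c by exact: cvg_cst.
have : (fun n => occ_excess v a w n / n%:R + (occ v w n)%:R / n%:R * q^-1) @ \oo
    --> 0 + mass R k (size v) * q^-1.
  by apply: cvgD; [exact: hw|apply: cvgM; [exact: hv|exact: cst]].
rewrite add0r size_rcons -m -massS m.
by move/cvg_ext; apply => n; rewrite /occ_excess; ring.
Qed.

Lemma ae_generic : {ae mu, forall w : boundary hk, generic (lw w)}.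
Proof.
apply: ae_imply ae_excess_free => w; apply: excess_free_generic.
exact: set_mem (valP w).
Qed.

End StrongLaw.

(** * Trees *)

Section Tree.
Variables (V : eqType) (e : rel V).
Hypothesis ht : is_tree e.
Implicit Types (x y z s t u v w : V) (p : seq V).

Lemma tree_sym : symmetric e. Proof. by case: ht. Qed.
Lemma tree_irr : irreflexive e. Proof. by case: ht. Qed.
Lemma tree_path x y : exists2 p, path e x p & last x p = y.
Proof. by case: ht. Qed.
Lemma tree_cycle c : ucycle e c -> size c <= 2. Proof. by case: ht => ? ? ? ?; exact. Qed.

(** Together with the edge, the simple path would close up to a cycle. *)
Lemma tree_uniq_edge s t p : e s t -> path e s p -> uniq (s :: p) -> last s p = t -> p = [:: t].
Proof.
move=> est pp up lp.
have : size (s :: p) <= 2.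
  apply: tree_cycle; rewrite /ucycle up andbT /= rcons_path pp lp tree_sym.
  exact: est.
case: p pp up lp => [|a [|? ?]] //= _ _ => [st|->//].
by rewrite st tree_irr in est.
Qed.

Definition cut_rel s t : rel V :=
  fun v w => e v w && ~~ [|| (v == s) && (w == t) | (v == t) && (w == s)].

(** The component of [t] after removal of the edge: the half-tree beyond the edge oriented from [s]
    to [t]. *)
Definition side s t v := `[< exists2 p, path (cut_rel s t) v p & last v p = t >].

Lemma cut_sym s t : symmetric (cut_rel s t).
Proof.
move=> v w; rewrite /cut_rel tree_sym orbC.
by congr (_ && ~~ (_ || _)); rewrite andbC.
Qed.

Lemma cutC s t : cut_rel s t =2 cut_rel t s.
Proof. by move=> v w; rewrite /cut_rel orbC. Qed.

Lemma side_head s t : side s t t.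
Proof. by apply/asboolP; exists [::]. Qed.

Lemma side_tail s t : e s t -> side s t s = false.
Proof.
move=> est; apply/asboolP => -[p pp lp].
case/shortenP: pp lp => p' pp' up' _ lp'.
have pe : path e s p' by apply: sub_path pp' => v w /andP[].
have p'E := tree_uniq_edge est pe up' lp'.
by move: pp'; rewrite p'E /= /cut_rel !eqxx andbF.
Qed.

Lemma side_cut s t v w : cut_rel s t v w -> side s t v = side s t w.
Proof.
have impl x y : cut_rel s t x y -> side s t y -> side s t x.
  move=> cxy /asboolP[p pp lp]; apply/asboolP; exists (y :: p) => //=.
  by rewrite cxy.
by move=> cvw; apply/idP/idP; apply: impl => //; rewrite cut_sym.
Qed.

Lemma side_step s t v w : e v w -> side s t v != side s t w ->
  (v = s /\ w = t) \/ (v = t /\ w = s).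
Proof.
move=> evw /eqP h; apply: contrapT => hn; apply: h; apply: side_cut.
rewrite /cut_rel evw /=; apply/norP.
by split; apply/negP => /andP[/eqP vE /eqP wE]; apply: hn; rewrite vE wE; auto.
Qed.

Lemma side_enter s t v w : e v w -> ~~ side s t v -> side s t w -> v = s /\ w = t.
Proof.
move=> evw nv sw; have ne : side s t v != side s t w by rewrite (negPf nv) sw.
case: (side_step evw ne) => // -[vt _].
by rewrite vt side_head in nv.
Qed.

Lemma side_swap s t v : e s t -> side t s v = ~~ side s t v.
Proof.
move=> est; have ets : e t s by rewrite tree_sym.
have [p + <-] := tree_path t v.
have : side t s t = ~~ side s t t by rewrite side_tail // side_head.
move: {2 4 5 7 9}t; elim: p => [//|w p IHp] u IHu /= /andP[euw]; apply: IHp.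
have [cuw|] := boolP (cut_rel s t u w).
  by rewrite -(side_cut cuw) -IHu; apply/esym/side_cut; rewrite cutC.
rewrite /cut_rel euw /= negbK => /orP[] /andP[/eqP ? /eqP ?]; subst u w.
  by rewrite side_tail // side_head.
by rewrite side_tail // side_head.
Qed.

(** The oriented edges traversed by a path are encoded as [zip (x :: p) p]. *)
Lemma path_enter s t x p : path e x p -> ~~ side s t x -> side s t (last x p) ->
  (s, t) \in zip (x :: p) p.
Proof.
elim: p x => [|y p IHp] x /=; first by move=> _ /negPf ->.
move=> /andP[exy pp] nx sl; rewrite inE.
have [sy|ny] := boolP (side s t y); last by rewrite IHp // orbT.
by have [-> ->] := side_enter exy nx sy; rewrite eqxx.
Qed.

Lemma mem_zip_path (x : V) p u w : (u, w) \in zip (x :: p) p -> u \in x :: p /\ w \in p.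
Proof.
elim: p x => [|y p IHp] x //=; rewrite inE => /orP[/eqP[-> ->]|/IHp[h1 h2]].
  by split; rewrite inE eqxx.
by split; apply/orP; right.
Qed.

Lemma zip_path_edge x p u w : path e x p -> (u, w) \in zip (x :: p) p -> e u w.
Proof.
elim: p x => [|y p IHp] x //= /andP[exy pp]; rewrite inE => /orP[/eqP[-> ->]//|].
exact: IHp.
Qed.

Lemma dist_ex x y : exists n, `[< exists p, [/\ path e x p, last x p = y & size p = n] >].
Proof. by have [p pp lp] := tree_path x y; exists (size p); apply/asboolP; exists p. Qed.

Definition dist x y := ex_minn (dist_ex x y).

Lemma dist_path x y : exists p, [/\ path e x p, last x p = y & size p = dist x y].
Proof. by rewrite /dist; case: ex_minnP => n /asboolP. Qed.

Lemma dist_le x p : path e x p -> dist x (last x p) <= size p.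
Proof.
by move=> pp; rewrite /dist; case: ex_minnP => n _; apply; apply/asboolP; exists p.
Qed.

Lemma dist_edge_le x s t : e s t -> dist x t <= (dist x s).+1.
Proof.
move=> est; have [p [pp lp <-]] := dist_path x s.
have := @dist_le x (rcons p t); rewrite rcons_path pp lp est last_rcons size_rcons.
exact.
Qed.

Lemma dist_triangle x y z : dist x z <= dist x y + dist y z.
Proof.
have [p [pp lp <-]] := dist_path x y; have [q [qp lq <-]] := dist_path y z.
have := @dist_le x (p ++ q); rewrite cat_path pp lp qp last_cat lp lq size_cat.
exact.
Qed.

Lemma dist_sym_le x y : dist x y <= dist y x.
Proof.
have [p [pp lp <-]] := dist_path y x.
have : path e x (rev (belast y p)).
  by rewrite -lp rev_path (eq_path (e' := e)) // => u w; rewrite /= tree_sym.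
move=> /dist_le; rewrite size_rev size_belast.
by case: p lp {pp} => [/= ->//|z p lp]; rewrite /= rev_cons last_rcons.
Qed.

Lemma distC x y : dist x y = dist y x.
Proof. by apply/eqP; rewrite eqn_leq !dist_sym_le. Qed.

Lemma dist0 x : dist x x = 0.
Proof. by apply/eqP; rewrite -leqn0; exact: (@dist_le x [::]). Qed.

Lemma dist_eq0 x y : dist x y = 0 -> x = y.
Proof. by have [p [_ <- <-]] := dist_path x y => /size0nil ->. Qed.

Lemma dist_eq1 x y : dist x y = 1 -> e x y.
Proof.
have [p [pp <- <-]] := dist_path x y.
by case: p pp => [|z [|? ?]] //= /andP[].
Qed.

Lemma dist_next x y : dist x y != 0 -> exists2 z, e x z & dist y x = (dist y z).+1.
Proof.
move=> xy; have [[|z p] [pp lp sp]] := dist_path x y; first by rewrite -sp in xy.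
move: pp => /= /andP[exz pp]; exists z => //; apply/eqP.
rewrite eqn_leq dist_edge_le 1?tree_sym // (distC y x) -sp /= ltnS.
by rewrite distC -[X in dist _ X]lp /= dist_le.
Qed.

Lemma dist_side s t z : e s t -> side s t z -> dist z s = (dist z t).+1.
Proof.
move=> est sz; apply/eqP; rewrite eqn_leq dist_edge_le; last by rewrite tree_sym.
rewrite distC (distC z); have [p [pp lp <-]] := dist_path s z.
have := @path_enter s t s p pp; rewrite side_tail // lp sz => /(_ isT isT)/mem_zip_path[_].
move=> /splitPr tp; case: tp pp lp => p1 p2; rewrite cat_path /= last_cat /= => /and3P[_ _ pp2] <-.
by rewrite (leq_ltn_trans (dist_le pp2)) // size_cat /= addnS ltnS leq_addl.
Qed.

Lemma dist_Nside s t z : e s t -> ~~ side s t z -> dist z t = (dist z s).+1.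
Proof. by move=> est; rewrite -side_swap // => /dist_side; apply; rewrite tree_sym. Qed.

(** Each edge of the path changes the distance to [z] by plus or minus one, according to the side on
    which [z] lies; geodesicity of the path is irrelevant. The equation of differences is written
    with sums to stay in [nat]. *)
Lemma dist_path_diff x p z z' : path e x p ->
  (forall u w, (u, w) \in zip (x :: p) p -> side u w z = side u w z') ->
  dist z (last x p) + dist z' x = dist z' (last x p) + dist z x.
Proof.
elim: p x => [|y p IHp] x /=; first by rewrite addnC.
move=> /andP[exy pp] h.
have {}IHp := IHp y pp (fun u w uw => h u w (mem_behead (s := _ :: _) uw)).
have := h x y (mem_head _ _); case: (boolP (side x y z)) => sz sz'.
  by have := dist_side exy sz; have := dist_side exy (esym sz'); lia.
by have := dist_Nside exy sz; have := @dist_Nside x y z' exy; rewrite -sz' => /(_ isT); lia.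
Qed.

Lemma size_separating x y (Q : seq (V * V)) : uniq Q ->
  {in Q, forall st, ~~ side st.1 st.2 x && side st.1 st.2 y} -> size Q <= dist x y.
Proof.
move=> uQ hQ; have [p [pp lp <-]] := dist_path x y.
have <- : size (zip (x :: p) p) = size p by rewrite size_zip /=; lia.
apply: uniq_leq_size => // -[s t] /hQ/andP[/= nx sy].
by apply: path_enter => //; rewrite lp.
Qed.

(** Convexity of half-trees: a path that enters and leaves passes through [s] twice. *)
Lemma uniq_path_Nside s t x p z : path e x p -> uniq (x :: p) ->
  ~~ side s t x -> ~~ side s t (last x p) -> z \in p -> ~~ side s t z.
Proof.
move=> pp up nx nl zp; apply/negP => sz.
case/splitPr: zp pp up nl => p1 p2.
rewrite -cat_rcons last_cat last_rcons cat_path last_rcons => /andP[pp1 pp2] up nl.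
have sl : side s t (last x (rcons p1 z)) by rewrite last_rcons.
have st := path_enter pp1 nx sl; have [s1 _] := mem_zip_path st.
have est := zip_path_edge pp1 st.
have s2 : s \in p2.
  have : (t, s) \in zip (z :: p2) p2; last by case/mem_zip_path.
  by apply: path_enter => //; rewrite side_swap // sz.
move: up; rewrite -cat_cons cat_uniq => /and3P[_ /hasPn/(_ s s2)].
by rewrite /= s1.
Qed.

Lemma side_nested s t u v : e s t -> e t u -> u != s -> side t u v -> side s t v.
Proof.
move=> est etu us tuv; have eut : e u t by rewrite tree_sym.
have sut : side s t u.
  rewrite (@side_cut s t u t) ?side_head // /cut_rel eut (negPf us) /=.
  by apply/negP => /andP[/eqP ut]; rewrite ut tree_irr in etu.
case/asboolP: tuv => p pp lp.
have tN z : z \in v :: p -> z != t.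
  move=> zp; apply/eqP => zt; subst z.
  have : side t u t; last by rewrite side_tail.
  case/splitPl: zp pp lp => p1 p2 lp1; rewrite cat_path last_cat lp1 => /andP[_ pp2] lp2.
  by apply/asboolP; exists p2.
have {pp} pp : path e v p by apply: sub_path pp => x y /andP[].
apply/negPn/negP => nv.
have := path_enter pp nv; rewrite lp => /(_ sut)/mem_zip_path[_ tp].
by have := tN t; rewrite inE tp orbT eqxx => /(_ isT).
Qed.

End Tree.

(** * Free actions on trees *)

Section Conn.
Variable k : nat.
Implicit Types (s t p u : seq (letter k)).

Lemma word_inv_cat s t : word_inv (s ++ t) = word_inv t ++ word_inv s.
Proof. by rewrite /word_inv map_cat rev_cat. Qed.

Lemma word_invK : involutive (@word_inv k).
Proof. by move=> s; rewrite /word_inv map_rev revK mapK //; exact: linvK. Qed.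

Lemma size_word_inv s : size (word_inv s) = size s.
Proof. by rewrite /word_inv size_rev size_map. Qed.

(** The label of the geodesic from [p] to [p'] in the Cayley graph, for reduced words of equal
    length. *)
Definition conn p p' := word_inv (drop (lcp p p') p) ++ drop (lcp p p') p'.

Lemma lcp_split p p' : size p = size p' -> p != p' ->
  exists c a b s t, [/\ p = c ++ a :: s, p' = c ++ b :: t, a != b & lcp p p' = size c].
Proof.
elim: p p' => [|a p IHp] [|b p'] //= [] sp; rewrite eqseq_cons.
case: eqVneq => [<-|ab] /= pp'; last by exists [::], a, b, p, p'.
have [c [a' [b' [s [t [-> -> ? ->]]]]]] := IHp _ sp pp'.
by exists (a :: c), a', b', s, t.
Qed.

Lemma size_conn p p' : size p = size p' -> size (conn p p') = 2 * size p - 2 * lcp p p'.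
Proof.
move=> sp; rewrite size_cat size_word_inv !size_drop -sp.
by have := lcp_size p p'; lia.
Qed.

Lemma conn_spec p p' : reduced p -> reduced p' -> size p = size p' -> p != p' ->
  exists c s t, [/\ p = c ++ s, p' = c ++ t, conn p p' = word_inv s ++ t, s != [::] & t != [::]]
    /\ reduced (conn p p').
Proof.
move=> rp rp' sp pp'; have [c [a [b [s [t [pE p'E ab lE]]]]]] := lcp_split sp pp'.
have cE : conn p p' = word_inv (a :: s) ++ b :: t.
  by rewrite /conn lE pE p'E !drop_size_cat.
exists c, (a :: s), (b :: t); split; first by split.
rewrite cE /word_inv /= rev_cons cat_rcons reduced_cat.
have rs : reduced (word_inv (a :: s)).
  by apply: reduced_inv; move: rp; rewrite pE => /reduced_catr.
have rt : reduced (b :: t) by move: rp'; rewrite p'E => /reduced_catr.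
move: rs; rewrite /word_inv /= rev_cons -cats1 reduced_cat => /and3P[-> _ h].
rewrite /= in h *; rewrite h andbT; move: rt; rewrite /reduced /= => ->.
by rewrite linvK eq_sym ab.
Qed.

Lemma fgw_conn p p' : reduced p -> reduced p' -> size p = size p' -> p != p' ->
  (fgw p * fgw (conn p p'))%g = fgw p'.
Proof.
move=> rp rp' sp pp'; have [c [s [t [[pE p'E cE _ _] _]]]] := conn_spec rp rp' sp pp'.
have rs : reduced s by move: rp; rewrite pE => /reduced_catr.
by rewrite cE {1}pE p'E !fgw_cat -fgw_inv // mulgA mulgK.
Qed.

(* If a reduced word [s] reads [conn p p'] from position [j], then the translate
   of [s] sending position [j] to [p] crosses the ball of radius [size p] along
   the geodesic from [p] to [p']. *)
Lemma crossing s p p' j : reduced s -> reduced p -> reduced p' -> size p = size p' ->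
  p != p' -> take (size (conn p p')) (drop j s) = conn p p' ->
  let h := (fgw p * (fgw (take j s))^-1)%g in
  let u := p ++ word_inv (take j s) in
  let u' := p' ++ drop (size (conn p p')) (drop j s) in
  [/\ reduced u, reduced u', h = fgw u & (h * fgw s)%g = fgw u'].
Proof.
move=> rs rp rp' sp pp' tE h u u'.
have [c [s1 [t1 [[pE p'E cE s10 t10] rc]]]] := conn_spec rp rp' sp pp'.
set g1 := take j s in h u *; set g3 := drop _ _ in u' *.
have sE : s = g1 ++ conn p p' ++ g3 by rewrite -tE !cat_take_drop.
have rg1 : reduced g1 by apply: reduced_take.
split.
- rewrite /u pE -catA reduced_overlap -?pE //.
  rewrite -(word_invK s1) -word_inv_cat reduced_inv //.
  by move: rs; rewrite sE cE -!catA catA => /reduced_catl.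
- rewrite /u' p'E -catA reduced_overlap -?p'E //.
  by move: rs; rewrite sE cE -!catA => /reduced_catr/reduced_catr.
- by rewrite /h /u fgw_cat fgw_inv.
rewrite /h [in fgw s]sE 2!fgw_cat /u' fgw_cat -(fgw_conn rp rp') //.
by rewrite !mulgA mulgKV.
Qed.

End Conn.

(** * Half-trees seen from an orbit *)

Section Action.
Variables (k : nat) (V : eqType) (e : rel V) (phi : free_group k -> V -> V).
Hypotheses (ht : is_tree e) (hact : is_simplicial_action e phi).
Hypothesis hfree : is_free phi.
Implicit Types (g h : free_group k) (s t u v w x y z : V).

Local Notation side := (side e).
Local Notation dist := (dist ht).

Lemma phi1 x : phi 1%g x = x. Proof. by case: hact. Qed.
Lemma phiM g h x : phi (g * h)%g x = phi g (phi h x). Proof. by case: hact. Qed.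
Lemma act_edge g x y : e (phi g x) (phi g y) = e x y. Proof. by case: hact. Qed.
Lemma phiK g : cancel (phi g) (phi g^-1%g).
Proof. by move=> x; rewrite -phiM mulVg phi1. Qed.
Lemma phiKV g : cancel (phi g^-1%g) (phi g).
Proof. by move=> x; rewrite -phiM mulgV phi1. Qed.
Lemma phi_inj g : injective (phi g). Proof. exact: can_inj (phiK g). Qed.

Lemma act_free g h x : phi g x = phi h x -> g = h.
Proof.
move=> gh; have /hfree : phi (h^-1 * g)%g x = x by rewrite phiM gh phiK.
by move/(congr1 (mulg h)); rewrite mulKVg mulg1.
Qed.

Lemma phi_path g x p : path e (phi g x) (map (phi g) p) = path e x p.
Proof. by elim: p x => //= y p IHp x; rewrite act_edge IHp. Qed.

Lemma side_act g s t v : side (phi g s) (phi g t) (phi g v) = side s t v.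
Proof.
have impl f a b c : side a b c -> side (phi f a) (phi f b) (phi f c).
  move=> /asboolP[p pp lp]; apply/asboolP; exists (map (phi f) p).
    elim: p c pp {lp} => //= y p IHp c /andP[cc /IHp ->]; rewrite andbT.
    by move: cc; rewrite /cut_rel /= act_edge !(inj_eq (@phi_inj f)).
  by rewrite last_map lp.
apply/idP/idP => [/(impl g^-1%g)|]; last exact: impl.
by rewrite !phiK.
Qed.

Lemma dist_act g x y : dist (phi g x) (phi g y) = dist x y.
Proof.
have le f a b : dist (phi f a) (phi f b) <= dist a b.
  have [p [pp lp <-]] := dist_path ht a b.
  by have := @dist_le _ _ ht (phi f a) (map (phi f) p); rewrite phi_path last_map lp size_map; apply.
apply/eqP; rewrite eqn_leq le /=.
by have := le g^-1%g (phi g x) (phi g y); rewrite !phiK.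
Qed.

Definition hside x s t g := side s t (phi g x).

Lemma hside1 x s t : hside x s t 1%g = side s t x.
Proof. by rewrite /hside phi1. Qed.

Lemma hsideM x s t g h : hside x (phi g s) (phi g t) (g * h)%g = hside x s t h.
Proof. by rewrite /hside phiM side_act. Qed.

Definition coboundary_in N x s t := forall g a,
  hside x s t g != hside x s t (g * gen a)%g -> wlen g < N.

Lemma coboundary_inW N M x s t : N <= M -> coboundary_in N x s t -> coboundary_in M x s t.
Proof. by move=> NM h g a /h; move=> /leq_trans; apply. Qed.

(** If [g] and [g * gen a] lie on different sides, then [g] carries some vertex of a fixed path from
    [x] to [gen a x] to an end of the edge. There are finitely many such vertices, and by freeness
    each is carried to a given end by at most one [g]. *)
Lemma coboundary_ex x s t : e s t -> exists N, coboundary_in N x s t.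
Proof.
move=> est; have ball u v : exists N, forall g, phi g u = v -> wlen g < N.
  have [[g0 h0]|h] := pselect (exists g, phi g u = v).
    by exists (wlen g0).+1 => g; rewrite -h0 => /act_free ->.
  by exists 0 => g hg; case: h; exists g.
have {}ball (L : seq V) v : exists N, forall g u, u \in L -> phi g u = v -> wlen g < N.
  elim: L => [|u L [N IHL]]; first by exists 0.
  have [M hM] := ball u v; exists (maxn N M) => g u'; rewrite inE leq_max.
  by case/orP => [/eqP -> /hM ->|/IHL h /h ->]; rewrite ?orbT.
have step (a : letter k) : exists N, forall g,
    hside x s t g != hside x s t (g * gen a)%g -> wlen g < N.
  have [p [pp lp _]] := dist_path ht x (phi (gen a) x).
  have [N hN] := ball (x :: p) s; have [M hM] := ball (x :: p) t.
  exists (maxn N M) => g hg; rewrite leq_max.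
  have [u up [us|ut]] : exists2 u, u \in x :: p & phi g u = s \/ phi g u = t.
    have hs : side s t (phi g x) != side s t (last (phi g x) (map (phi g) p)).
      by rewrite last_map lp -phiM.
    have pg : path e (phi g x) (map (phi g) p) by rewrite phi_path.
    case sx : (side s t (phi g x)) hs => hs.
      have : (t, s) \in zip (phi g x :: map (phi g) p) (map (phi g) p).
        apply: (path_enter ht) => //; rewrite (side_swap ht) // ?sx //.
      move=> /mem_zip_path[_ /mapP[u up su]].
      by exists u; [rewrite inE up orbT|left].
    have : (s, t) \in zip (phi g x :: map (phi g) p) (map (phi g) p).
      apply: (path_enter ht) => //; first by rewrite sx.
      by move: hs; case: (side s t _).
    move=> /mem_zip_path[_ /mapP[u up su]].
    by exists u; [rewrite inE up orbT|right].
  by rewrite (hN g u).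
  by rewrite (hM g u) ?orbT.
have [N hN] := choice step; exists (\max_a N a) => g a /hN /leq_trans; apply.
exact: leq_bigmax.
Qed.

Lemma coboundary_seq x (L : seq (V * V)) : {in L, forall st, e st.1 st.2} ->
  exists N, {in L, forall st, coboundary_in N x st.1 st.2}.
Proof.
elim: L => [|st L IHL] hL; first by exists 0.
have [N hN] := coboundary_ex x (hL st (mem_head _ _)).
have [|M hM] := IHL; first by move=> r rL; apply: hL; rewrite inE rL orbT.
exists (maxn N M) => r; rewrite inE => /orP[/eqP ->|/hM].
  by apply: coboundary_inW hN; rewrite leq_maxl.
by apply: coboundary_inW; rewrite leq_maxr.
Qed.

Lemma cone_side N x s t (p r : seq (letter k)) : coboundary_in N x s t ->
  N <= size p -> reduced (p ++ r) -> hside x s t (fgw (p ++ r)) = hside x s t (fgw p).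
Proof.
move=> hN Np; elim/last_ind: r => [|r a IHr]; first by rewrite cats0.
rewrite -rcons_cat => rr; have rpr : reduced (p ++ r).
  by move: rr; rewrite -cats1 => /reduced_catl.
rewrite -IHr // fgw_rcons; apply/eqP/contraT; rewrite eq_sym => /hN.
by rewrite wlen_fgw // size_cat; lia.
Qed.

Lemma dist_orbit_le x : exists C, forall g, dist x (phi g x) <= C * wlen g.
Proof.
exists (\max_a dist x (phi (gen a) x)) => g; rewrite -(fgwK g) wlen_fgw ?(valP g) //.
elim: (val g) => [|a r IHr]; first by rewrite fgw_nil phi1 dist0.
rewrite fgw_cons phiM (leq_trans (dist_triangle ht _ (phi (gen a) x) _)) //.
rewrite dist_act mulnS leq_add //.
by apply: (leq_bigmax (F := fun a => dist x (phi (gen a) x))).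
Qed.

(** Seen from [z = (r v)^-1 x], the increment is governed by the sides of [z] along a fixed path
    from [x] to [gen a x]. By [cone_side] these depend only on the first [N] letters of [(r v)^-1],
    that is, on [v]. *)
Lemma dist_increment x : exists N, forall (r v : seq (letter k)) a,
  size v = N -> reduced (r ++ rcons v a) ->
  dist x (phi (fgw (r ++ rcons v a)) x) + dist x (phi (fgw v) x) =
  dist x (phi (fgw (rcons v a)) x) + dist x (phi (fgw (r ++ v)) x).
Proof.
have /choice[P hP] (a : letter k) : exists p, path e x p /\ last x p = phi (gen a) x.
  by have [p] := tree_path ht x (phi (gen a) x); exists p.
have [|N hN] := @coboundary_seq x (flatten [seq zip (x :: P a) (P a) | a <- enum {: letter k}]).
  move=> [u w] /flatten_mapP[a _]; have [pa _] := hP a; exact: zip_path_edge.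
exists N => r v a sv rr; have [pa la] := hP a.
pose z (r : seq (letter k)) := phi (fgw r)^-1%g x.
have dz r' y : dist (z r') y = dist x (phi (fgw r') y) by rewrite /z -(dist_act (fgw r')) phiKV.
have := @dist_path_diff _ _ ht x (P a) (z (r ++ v)) (z v) pa.
rewrite la !dz -!phiM -!fgw_rcons rcons_cat [RHS]addnC addnC; apply => u w uw.
have rrv : reduced (r ++ v).
  by move: rr; rewrite -rcons_cat -cats1 => /reduced_catl.
rewrite /z !fgw_inv //; last exact: reduced_catr rrv.
rewrite word_inv_cat; apply: (@cone_side N).
- apply: (hN (u, w)); apply/flatten_mapP; exists a => //; exact: mem_enum.
- by rewrite size_word_inv sv.
- by rewrite -word_inv_cat reduced_inv.
Qed.

End Action.

(** * The stretching factor and crossings of edges *)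

Section BoundedDiff.
Local Open Scope classical_set_scope.
Local Open Scope ring_scope.
Variable R : realType.

Lemma cvg_inv_nat : (fun n => n%:R^-1 : R) @ \oo --> (0 : R).
Proof. by rewrite -(cvg_shiftS (fun n => n%:R^-1 : R)); exact: cvg_harmonic. Qed.

Lemma cvg_bounded_diff (a b : nat -> R) (C l : R) : (forall n, `|a n - b n| <= C) ->
  (fun n => a n / n%:R) @ \oo --> l -> (fun n => b n / n%:R) @ \oo --> l.
Proof.
move=> ab al.
have d0 : (fun n => (a n - b n) / n%:R) @ \oo --> (0 : R).
  have c0 : (fun n => C * n%:R^-1) @ \oo --> (0 : R).
    by rewrite -(mulr0 C); apply: cvgM; [exact: cvg_cst|exact: cvg_inv_nat].
  apply: (@squeeze_cvgr _ _ _ _ (fun n => - (C * n%:R^-1)) (fun n => C * n%:R^-1)) => //.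
    near=> n; have n0 : 0 <= n%:R^-1 :> R by rewrite invr_ge0.
    by rewrite -ler_norml normrM (ger0_norm n0) ler_wpM2r.
  by rewrite -oppr0; exact: cvgN.
have : (fun n => a n / n%:R - (a n - b n) / n%:R) @ \oo --> l - 0 by exact: cvgB.
by rewrite subr0; move/cvg_ext; apply => n; ring.
Unshelve. all: by end_near.
Qed.

End BoundedDiff.

Section Stretching.
Local Open Scope classical_set_scope.
Local Open Scope ring_scope.
Variables (R : realType) (k : nat).
Variables (V : eqType) (e : rel V) (phi : free_group k -> V -> V).
Hypotheses (ht : is_tree e) (hact : is_simplicial_action e phi).
Hypotheses (hfree : is_free phi).
Implicit Types (w : nat -> letter k).

Local Notation dist := (dist ht).
Lemma path_distE x y : path_dist e R x y = (dist x y)%:R.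
Proof.
have [p [pp lp sp]] := dist_path ht x y.
apply/eqP; rewrite eq_le /path_dist; apply/andP; split.
  apply: ge_inf; first by exists 0 => _ [r _ <-].
  by exists p => //; rewrite sp.
apply: lb_le_inf; first by exists (size p)%:R; exists p.
by move=> _ [r [pr <-] <-]; rewrite ler_nat; exact: dist_le.
Qed.

Definition inf_word w := forall i, w i.+1 != linv (w i).

Lemma reduced_mkseq w n : inf_word w -> reduced (mkseq w n).
Proof.
move=> hw; apply/(sortedP (w 0%N)) => i; rewrite size_mkseq => ilt.
by rewrite !nth_mkseq //; exact: ltnW.
Qed.

Lemma reduced_window w j m : inf_word w -> reduced (window w j m).
Proof.
move=> hw; rewrite -(@take_drop_prefix _ w j m (j + m)) //.
by apply/reduced_take/reduced_drop/reduced_mkseq.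
Qed.

Definition disp x w n : R := (dist x (phi (fgw (mkseq w n)) x))%:R.

Lemma mkseq_cat w m n : mkseq w (m + n) = mkseq w m ++ window w m n.
Proof.
rewrite -(cat_take_drop m (mkseq w (m + n))) -(@take_drop_prefix _ w m n (m + n)) //.
rewrite (@take_oversize _ n) ?size_drop ?size_mkseq ?addKn //.
have := @take_drop_prefix _ w 0 m (m + n) (leq_addr _ _).
by rewrite drop0 => ->.
Qed.

Lemma disp_bounded_shift x N : exists C : R, forall w, inf_word w ->
  forall n, `|disp x w (N + n) - disp x w n| <= C.
Proof.
have [C hC] := dist_orbit_le ht hact x.
exists (C * N)%:R => w hw n; rewrite addnC /disp mkseq_cat fgw_cat.
set g := fgw (mkseq w n); set h := fgw _.
have hh : (dist x (phi h x) <= C * N)%N.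
  by have := hC h; rewrite /h wlen_fgw ?reduced_window // size_mkseq.
have h1 : (dist x (phi (g * h)%g x) <= dist x (phi g x) + dist x (phi h x))%N.
  by rewrite (phiM hact) (leq_trans (dist_triangle ht _ (phi g x) _)) // (dist_act ht hact).
have h2 : (dist x (phi g x) <= dist x (phi (g * h)%g x) + dist x (phi h x))%N.
  rewrite (leq_trans (dist_triangle ht _ (phi (g * h)%g x) _)) // leq_add2l.
  by rewrite (phiM hact) (dist_act ht hact) (distC ht).
rewrite ler_norml lerBlDl -!natrD lerNl opprB lerBlDl -natrD !ler_nat.
by apply/andP; split; lia.
Qed.

Lemma disp_cvg x : exists l : R, forall w, inf_word w -> generic R w ->
  (fun n => disp x w n / n%:R) @ \oo --> l.
Proof.
have [N hN] := dist_increment ht hact hfree x.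
have [C hC] := disp_bounded_shift x N.
pose F (u : seq (letter k)) : R := (dist x (phi (fgw u) x))%:R -
  (dist x (phi (fgw (take N u)) x))%:R.
exists (\sum_(u <- rwords k N.+1 | reduced u && (u != [::])) F u * mass R k (size u)) => w hw gw.
apply: (cvg_bounded_diff (hC w hw)).
have dispE n : disp x w (N + n) = disp x w N + \sum_(u <- rwords k N.+1) F u * (occ u w n)%:R.
  elim: n => [|n IHn].
    by rewrite addn0 big1 ?addr0 // => u _; rewrite occ0 mulr0.
  have wr : window w n N.+1 \in rwords k N.+1.
    by rewrite mem_rwords reduced_window // size_mkseq eqxx.
  rewrite (eq_big_seq (fun u => F u * (occ u w n)%:R + F u * (window w n N.+1 == u)%:R)); last first.
    by move=> u ru; rewrite occS natrD mulrDr (size_rwords ru).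
  rewrite big_split /= addrA -IHn (bigD1_seq _ wr) ?rwords_uniq //= eqxx mulr1.
  rewrite big1 ?addr0; last by move=> u; rewrite eq_sym => /negPf ->; rewrite mulr0.
  have := hN (mkseq w n) (window w n N) (w (n + N)%N) (size_mkseq _ _).
  rewrite -window_rcons -!mkseq_cat (addnC n N.+1) (addnC n N) => /(_ (reduced_mkseq _ hw)).
  have -> : window w n N = take N (window w n N.+1).
    by rewrite window_rcons -cats1 take_size_cat // size_mkseq.
  rewrite /F /disp addnS => /(congr1 (fun m => m%:R : R)).
  rewrite !natrD addSn => h.
  by rewrite addrA -[RHS]addrA; apply/eqP; rewrite -subr_eq0; apply/eqP; lra.
apply: (@cvg_bounded_diff _ (fun n => \sum_(u <- rwords k N.+1) F u * (occ u w n)%:R) _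
  `|disp x w N|).
  by move=> n; rewrite dispE opprD addrCA subrr addr0 normrN.
have : (fun n => \sum_(u <- rwords k N.+1 | reduced u && (u != [::]))
    F u * ((occ u w n)%:R / n%:R)) @ \oo -->
    \sum_(u <- rwords k N.+1 | reduced u && (u != [::])) F u * mass R k (size u).
  apply: (@cvg_sum _ _ _ _ (fun u n => F u * ((occ u w n)%:R / n%:R))) => u /andP[ru u0].
  by apply: cvgM; [exact: cvg_cst|exact: gw].
move/cvg_ext; apply => n; rewrite big_distrl /= [RHS]big_seq [LHS]big_seq_cond.
apply: eq_big => [u|u _]; last by rewrite mulrA.
rewrite mem_rwords; case: (reduced u) => //=.
by case: u => [|b u] /=; rewrite ?andbF ?andbT.
Qed.

End Stretching.

(** * Counting the translates of edges crossed *)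

Section LowerBound.
Variables (R : realType) (k : nat) (hk : (2 <= k)%N).
Variables (V : eqType) (e : rel V) (phi : free_group k -> V -> V).
Hypotheses (ht : is_tree e) (hact : is_simplicial_action e phi).
Hypotheses (hfree : is_free phi).
Implicit Types (w : nat -> letter k) (p s : seq (letter k)) (r : V * V).

Local Notation dist := (dist ht).
Local Notation hside := (hside e phi).

Definition inequivalent (Q : seq (V * V)) :=
  {in Q &, forall r r' g, phi g r.1 = r'.1 -> phi g r.2 = r'.2 -> r = r'}.

Variables (x : V) (Q : seq (V * V)) (N : nat).
Hypotheses (Q_uniq : uniq Q) (Q_edge : {in Q, forall r, e r.1 r.2}).
Hypothesis Q_ineq : inequivalent Q.
Hypothesis Q_cob : {in Q, forall r, coboundary_in e phi N x r.1 r.2}.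

(** Each term counted gives a translate of an edge of [Q] separating [x] from [s x], and different
    terms give different translates: the translate determines the edge by inequivalence and the
    element [h] by freeness, and the normal forms of [h] and [h s] then reveal [p], [p'] and [j]. *)
Lemma crossings_le s n : reduced s ->
  \sum_(r <- Q) \sum_(p <- rwords k N) \sum_(p' <- rwords k N)
    (~~ hside x r.1 r.2 (fgw p) && hside x r.1 r.2 (fgw p')) *
    \sum_(j < n) (take (size (conn p p')) (drop j s) == conn p p')
  <= dist x (phi (fgw s) x).
Proof.
move=> rs.
pose T := [seq (r, pp) | r <- Q, pp <- [seq (p, pj) | p <- rwords k N,
  pj <- [seq (p', j) | p' <- rwords k N, j <- index_iota 0 n]]].
pose C (t : (V * V) * (seq (letter k) * (seq (letter k) * nat))) :=
  let: (r, (p, (p', j))) := t in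
  (~~ hside x r.1 r.2 (fgw p) && hside x r.1 r.2 (fgw p'))
  && (take (size (conn p p')) (drop j s) == conn p p').
pose h (t : (V * V) * (seq (letter k) * (seq (letter k) * nat))) :=
  let: (r, (p, (p', j))) := t in (fgw p * (fgw (take j s))^-1)%g.
pose E t := (phi (h t)^-1%g t.1.1, phi (h t)^-1%g t.1.2).
have -> : \sum_(r <- Q) \sum_(p <- rwords k N) \sum_(p' <- rwords k N)
    (~~ hside x r.1 r.2 (fgw p) && hside x r.1 r.2 (fgw p')) *
    \sum_(j < n) (take (size (conn p p')) (drop j s) == conn p p') =
  size [seq E t | t <- [seq t <- T | C t]].
  rewrite size_map size_filter -sum1_count [RHS]big_mkcond /T [RHS]big_allpairs.
  apply: eq_bigr => r _; rewrite [RHS]big_allpairs; apply: eq_bigr => p _.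
  rewrite [RHS]big_allpairs; apply: eq_bigr => p' _.
  rewrite [RHS]big_mkord big_distrr; apply: eq_bigr => j _ /=.
  by rewrite mulnb; case: (_ && _).
have uT : uniq T.
  do 2 (apply: allpairs_uniq; rewrite ?rwords_uniq //; last by move=> [? ?] [? ?] _ _ [-> ->]).
  by apply: allpairs_uniq; rewrite ?rwords_uniq ?iota_uniq //; move=> [? ?] [? ?] _ _ [-> ->].
have CP t : t \in [seq t <- T | C t] -> exists r p p' j,
  [/\ t = (r, (p, (p', j))), r \in Q, p \in rwords k N, p' \in rwords k N &
   [/\ hside x r.1 r.2 (fgw p) = false, hside x r.1 r.2 (fgw p'), p != p',
     take (size (conn p p')) (drop j s) = conn p p' & (j < n)%N]].
  rewrite mem_filter => /andP[Ct /allpairsP[[r pp] [/= rQ ppT tE]]]; subst t.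
  move: ppT => /allpairsP[[p pj] [/= rp pjT ppE]]; subst pp.
  move: pjT => /allpairsP[[p' j] [/= rp' jn pjE]]; subst pj.
  move: Ct jn => /andP[/andP[/negPf h1 h2] /eqP h3]; rewrite mem_index_iota => /andP[_ jn].
  exists r, p, p', j; do !split => //.
  by apply: contraTneq h2 => <-; rewrite h1.
have crossE t : t \in [seq t <- T | C t] -> exists r p p' j,
  let u := p ++ word_inv (take j s) in
  let u' := p' ++ drop (size (conn p p')) (drop j s) in
  [/\ t = (r, (p, (p', j))), r \in Q, size p = N /\ size p' = N, (j <= size s)%N &
   [/\ reduced u, reduced u', h t = fgw u, (h t * fgw s)%g = fgw u' &
       ~~ side e (E t).1 (E t).2 x && side e (E t).1 (E t).2 (phi (fgw s) x)]].
  move=> /CP[r [p [p' [j [tE rQ rp rp' [h1 h2 pp' tk jn]]]]]].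
  exists r, p, p', j; move: (rp) (rp'); rewrite !mem_rwords => /andP[redp /eqP sp] /andP[redp' /eqP sp'].
  have spp : size p = size p' by rewrite sp sp'.
  have [c1 c2 c3 c4] := crossing rs redp redp' spp pp' tk.
  (* Past the end of [s] only the empty word is read, and [conn p p'] is not empty. The bound lets
     [j] be recovered as the length of [take j s]. *)
  have jsz : (j <= size s)%N.
    rewrite leqNgt; apply/negP => sj; move: tk; rewrite drop_oversize ?(ltnW sj) //= => tk.
    have [c [s1 [t1 [[_ _ cE s10 t10] _]]]] := conn_spec redp redp' spp pp'.
    by move: tk; rewrite cE; case: (t1) t10 => // ? ? _; case: (word_inv s1).
  split => //; split => //; [by rewrite tE|by rewrite tE|].
  rewrite tE /E /=; set hh := (fgw p * _)%g in c3 c4 *.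
  rewrite -[X in ~~ side _ _ _ X](phiK hact hh) -[X in _ && side _ _ _ X](phiK hact hh).
  rewrite !(side_act hact) -(phiM hact) c3 -c3 c4 c3.
  rewrite -!/(hside x r.1 r.2 _) !(cone_side (Q_cob rQ)) ?sp ?sp' //.
  by rewrite h1 h2.
apply: size_separating; last first.
  by move=> _ /mapP[t /crossE[r [p [p' [j [_ _ _ _ [_ _ _ _ ?]]]]]] ->].
rewrite map_inj_in_uniq ?filter_uniq // => t t2 tin t2in.
have [r [p [p' [j [tE rQ [sp sp'] js [ru ru' hu hu' _]]]]]] := crossE t tin.
have [r2 [p2 [p2' [j2 [tE2 rQ2 [sp2 sp2'] js2 [ru2 ru2' hu2 hu2' _]]]]]] := crossE t2 t2in.
move=> [E1 E2].
have rr : r = r2.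
  apply: (Q_ineq rQ rQ2 (g := (h t2 * (h t)^-1)%g)).
    by move: E1; rewrite tE tE2 /= (phiM hact) => ->; rewrite (phiKV hact).
  by move: E2; rewrite tE tE2 /= (phiM hact) => ->; rewrite (phiKV hact).
have hh : h t = h t2.
  apply: invg_inj; apply: (act_free hact hfree (x := r.1)).
  have t1 : t.1 = r by rewrite tE.
  have t21 : t2.1 = r by rewrite tE2 rr.
  by move: E1; rewrite t1 t21.
have uu : p ++ word_inv (take j s) = p2 ++ word_inv (take j2 s).
  by rewrite -(val_fgw ru) -(val_fgw ru2) -hu -hu2 hh.
have uu' : p' ++ drop (size (conn p p')) (drop j s) = p2' ++ drop (size (conn p2 p2')) (drop j2 s).
  by rewrite -(val_fgw ru') -(val_fgw ru2') -hu' -hu2' hh.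
have /eqP := uu; rewrite eqseq_cat ?sp ?sp2 // => /andP[/eqP pp /eqP wj].
have /eqP := uu'; rewrite eqseq_cat ?sp' ?sp2' // => /andP[/eqP pp' _].
have jj : j = j2.
  by have := congr1 size wj; rewrite !size_word_inv !size_takel.
by rewrite tE tE2 rr pp pp' jj.
Qed.

Local Open Scope classical_set_scope.
Local Open Scope ring_scope.

Let q : R := 2 * k%:R - 1.

Lemma cost_le_stretch w (l : R) n : N = n.+1 -> inf_word w -> generic R w ->
  (fun n => disp R phi ht x w n / n%:R) @ \oo --> l ->
  \sum_(r <- Q) (cost n.+1 (fun p => hside x r.1 r.2 (fgw p)))%:R
    <= l * (2 * k%:R * q ^+ (2 * n).+1).
Proof.
move=> NE hw gw wl.
have q3 := qr_ge3 R hk; rewrite -/q in q3; have q0 : 0 < q by lra.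
have k0 : 0 < k%:R :> R by rewrite ltr0n; lia.
have [C hC] := disp_bounded_shift R ht hact x (2 * N).
pose c r p p' := ~~ hside x r.1 r.2 (fgw p) && hside x r.1 r.2 (fgw p').
pose L m : R := \sum_(r <- Q) \sum_(p <- rwords k N) \sum_(p' <- rwords k N)
  (c r p p')%:R * (occ (conn p p') w m)%:R.
(* Connecting words have at most [2 * N] letters, so those starting before [m] fit in this
   prefix. *)
have Lle m : L m <= disp R phi ht x w (2 * N + m).
  have := crossings_le m (reduced_mkseq (2 * N + m) hw); rewrite -(ler_nat R).
  apply: le_trans; rewrite natr_sum le_eqVlt; apply/orP; left; apply/eqP.
  apply: eq_bigr => r _; rewrite natr_sum; apply: eq_big_seq => p rp.
  rewrite natr_sum; apply: eq_big_seq => p' rp'; rewrite natrM; congr (_ * _%:R).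
  apply: eq_bigr => j _; rewrite take_drop_prefix //.
  rewrite size_conn ?(size_rwords rp) ?(size_rwords rp') //.
  by have := ltn_ord j; lia.
have Llim : (fun m => L m / m%:R) @ \oo --> \sum_(r <- Q) \sum_(p <- rwords k N) \sum_(p' <- rwords k N)
  (c r p p')%:R * (lcp_ker p p')%:R / (2 * k%:R * q ^+ (2 * n).+1).
  have : (fun m => \sum_(r <- Q) \sum_(p <- rwords k N) \sum_(p' <- rwords k N)
      (c r p p')%:R * ((occ (conn p p') w m)%:R / m%:R)) @ \oo -->
    \sum_(r <- Q) \sum_(p <- rwords k N) \sum_(p' <- rwords k N)
      (c r p p')%:R * (lcp_ker p p')%:R / (2 * k%:R * q ^+ (2 * n).+1).
    apply: cvg_sum_seq => r rQ; apply: cvg_sum_seq => p rp; apply: cvg_sum_seq => p' rp'.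
    rewrite -mulrA; case cE : (c r p p'); last first.
      rewrite mul0r; apply: (@cvg_ext _ (fun=> 0)) => [m|]; first by rewrite mul0r.
      exact: cvg_cst.
    apply: cvgM; first exact: cvg_cst.
    have pp' : p != p'.
      by apply: contraTneq cE => ->; rewrite /c andNb.
    move: (rp) (rp'); rewrite !mem_rwords => /andP[redp /eqP sp] /andP[redp' /eqP sp'].
    have spp : size p = size p' by rewrite sp sp'.
    have [_ [s1 [t1 [[_ _ cnE s10 _] rc]]]] := conn_spec redp redp' spp pp'.
    have lN : (lcp p p' < n.+1)%N.
      have [c' [a [b [s2 [t2 [pE _ _ ->]]]]]] := lcp_split spp pp'.
      by rewrite -NE -sp pE size_cat /= addnS ltnS leq_addr.
    have mE : mass R k (size (conn p p')) = (lcp_ker p p')%:R / (2 * k%:R * q ^+ (2 * n).+1).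
      rewrite size_conn // sp NE /mass /lcp_ker natrX natr_q //.
      have expE m : (m < n.+1)%N -> (2 * n).+1 = ((2 * n.+1 - 2 * m).-1 + 2 * m)%N.
        by clear; lia.
      rewrite (expE _ lN).
      rewrite exprD mulrA [in RHS]invfM mulrCA mulfV ?mulr1 //.
      by rewrite expf_neq0 // gt_eqF.
    rewrite -mE; apply: gw => //.
    by rewrite cnE -size_eq0 size_cat size_word_inv; case: (s1) s10.
  move/cvg_ext; apply => m; rewrite /L !big_distrl; apply: eq_bigr => r _ /=.
  rewrite big_distrl; apply: eq_bigr => p _ /=.
  by rewrite big_distrl; apply: eq_bigr => p' _ /=; rewrite mulrA.
have wl' : (fun m => disp R phi ht x w (2 * N + m) / m%:R) @ \oo --> l.
  apply: cvg_bounded_diff wl => m; rewrite distrC; exact: hC.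
have : \sum_(r <- Q) \sum_(p <- rwords k N) \sum_(p' <- rwords k N)
  (c r p p')%:R * (lcp_ker p p')%:R / (2 * k%:R * q ^+ (2 * n).+1) <= l.
  apply: (ler_cvg_to Llim wl'); apply: nearW => m.
  by rewrite ler_wpM2r ?invr_ge0.
have D0 : 0 < 2 * k%:R * q ^+ (2 * n).+1.
  by rewrite mulr_gt0 ?exprn_gt0 ?mulr_gt0 //; lra.
rewrite -ler_pdivrMr //; apply: le_trans; rewrite le_eqVlt; apply/orP; left; apply/eqP.
rewrite big_distrl /=; apply: eq_bigr => r _.
(* The crossings counted enter the half-tree, whereas [cost] starts inside it. *)
rewrite -costC /cost natr_sum big_distrl -NE /=; apply: eq_bigr => p _.
rewrite natr_sum big_distrl; apply: eq_bigr => p' _ /=.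
by rewrite natrM negbK.
Qed.

End LowerBound.

(** * Minimality and the number of edge orbits *)

Section Minimal.
Variables (k : nat) (V : eqType) (e : rel V) (phi : free_group k -> V -> V).
Hypotheses (ht : is_tree e) (hact : is_simplicial_action e phi).
Hypotheses (hinv : without_inversions e phi) (hmin : is_minimal e phi).
Implicit Types (g h : free_group k) (s t u v w x y z : V).

Local Notation side := (side e).
Local Notation dist := (dist ht).
Local Notation hside := (hside e phi).

(** Otherwise the vertices outside all translates of the half-tree form a proper invariant
    subtree. *)
Lemma side_orbit s t v : e s t -> exists g, side s t (phi g v).
Proof.
move=> est; apply: contrapT => noside.
pose S : set V := fun z => forall h, ~~ side (phi h s) (phi h t) z.
have ST : S = setT.
  apply: hmin; last first.
    move=> g z Sz h; rewrite -(side_act hact g^-1%g) (phiK hact) -!(phiM hact).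
    exact: Sz.
  split.
    exists v => h; apply/negP => shv; apply: noside; exists h^-1%g.
    by rewrite -(side_act hact h) (phiKV hact).
  move=> x y Sx Sy; have [p0 pp0 lp0] := tree_path ht x y.
  case/shortenP: pp0 lp0 => p pp up _ lp; exists p; split => // z zp h.
  by apply: (uniq_path_Nside ht pp up) => //; rewrite lp.
have : S t by rewrite ST.
by move=> /(_ 1%g); rewrite !(phi1 hact) side_head.
Qed.

(** If [t] were a leaf, an orbit point of [s] beyond the edge could only be [t]; the element
    carrying [s] to [t] would then invert the edge. *)
Lemma other_neighbour s t : e s t -> exists2 u, e t u & u != s.
Proof.
move=> est; apply: contrapT => noedge.
have only u : e t u -> u = s.
  by move=> etu; apply/eqP; apply: contrapT => /negP us; apply: noedge; exists u.
have [g /asboolP[p pp lp]] := side_orbit s est.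
have gst : phi g s = t.
  case/lastP: p pp lp => [//|p a]; rewrite rcons_path last_rcons => /andP[_ +] at_.
  rewrite at_ {at_}; move: (last _ p) => b /andP[ebt].
  have -> : b = s by apply: only; rewrite (tree_sym ht).
  by rewrite !eqxx.
have gts : phi g t = s by apply: only; rewrite -{1}gst (act_edge hact).
exact: (hinv est (conj gst gts)).
Qed.

Lemma side_orbit_far x n s t : e s t ->
  exists2 g, side s t (phi g x) & n <= dist (phi g x) s.
Proof.
elim: n s t => [|n IHn] s t est.
  by have [g sg] := side_orbit x est; exists g.
have [u etu us] := other_neighbour est.
have [g sg ng] := IHn _ _ etu.
have sgt := side_nested ht est etu us sg.
by exists g => //; rewrite (dist_side ht est sgt) ltnS.
Qed.

(** An orbit point far out in the half-tree comes from a long word, whose prefix of length [N] is on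
    the same side. *)
Lemma has_hside x s t N : e s t -> coboundary_in e phi N x s t ->
  has (fun p => hside x s t (fgw p)) (rwords k N).
Proof.
move=> est cN; have [C hC] := dist_orbit_le ht hact x.
have [g sg ng] := side_orbit_far x (C * N + dist x s).+1 est.
have Ng : N <= wlen g.
  rewrite leqNgt; apply/negP => gN.
  have := dist_triangle ht (phi g x) x s; rewrite (distC ht (phi g x) x).
  have : C * wlen g <= C * N by rewrite leq_mul2l ltnW ?orbT.
  by have := hC g; lia.
have rg := valP g.
apply/hasP; exists (take N (val g)).
  by rewrite mem_rwords reduced_take // size_takel ?eqxx.
rewrite -(cone_side (r := drop N (val g)) cN) ?size_takel //; rewrite cat_take_drop //.
by rewrite fgwK.
Qed.

Lemma hside_swap x s t g : e s t -> hside x t s g = ~~ hside x s t g.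
Proof. exact: side_swap. Qed.

Lemma coboundary_in_swap N x s t : e s t -> coboundary_in e phi N x s t ->
  coboundary_in e phi N x t s.
Proof.
move=> est cN g a; rewrite (hside_swap x g est) (hside_swap x _ est) => h; apply: (cN g a).
by apply: contraNneq h => ->.
Qed.

Lemma has_hsideC x s t N : e s t -> coboundary_in e phi N x s t ->
  has (predC (fun p => hside x s t (fgw p))) (rwords k N).
Proof.
move=> est cN; have ets : e t s by rewrite (tree_sym ht).
have [p rp] := hasP (has_hside ets (coboundary_in_swap est cN)).
by rewrite (hside_swap x _ est) => hp; apply/hasP; exists p.
Qed.

End Minimal.

(** * The number of edge orbits is at least the rank *)

Section Rank.
Variables (k : nat) (V : eqType) (e : rel V) (phi : free_group k -> V -> V).
Hypotheses (ht : is_tree e) (hact : is_simplicial_action e phi) (hfree : is_free phi).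
Implicit Types (g h : free_group k) (v w x y z : V) (c : {ffun 'I_k -> bool}).

Definition parity c g := \big[addb/false]_(a <- val g) c a.1.

Lemma parity_push c a (s : seq (letter k)) :
  \big[addb/false]_(b <- push a s) c b.1 = c a.1 (+) \big[addb/false]_(b <- s) c b.1.
Proof.
case: s => [|b s]; first by rewrite big_seq1 big_nil addbF.
by rewrite /=; case: eqP => [->|_]; rewrite !big_cons //= addbA addbb.
Qed.

Lemma parityM c g h : parity c (g * h)%g = parity c g (+) parity c h.
Proof.
rewrite /parity /=; elim: (val g) => [|a s IHs] /=; first by rewrite big_nil.
by rewrite parity_push IHs big_cons addbA.
Qed.

Lemma parity_gen c a : parity c (gen a) = c a.1.
Proof. by rewrite /parity big_seq1. Qed.

Definition edge_equiv (r r' : V * V) := exists g,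
  (phi g r.1 = r'.1 /\ phi g r.2 = r'.2) \/ (phi g r.1 = r'.2 /\ phi g r.2 = r'.1).

Definition complete (Q : seq (V * V)) := forall v w, e v w -> exists2 r, r \in Q & edge_equiv r (v, w).

(* A class [c] in [Hom(F, Z/2)] is the coboundary of a [Z/2]-valued function on
   vertices whose differences along edges are [F]-invariant, so it is determined
   by one bit per orbit of edges. *)
Lemma rank_le_edges Q : complete Q -> k <= size Q.
Proof.
move=> cQ; have [x0] : inhabited V by case: ht.
pose orb v : set V := fun w => exists g, phi g w = v.
have /choice[pick pickP] (A : set V) : exists w, (exists w', A w') -> A w.
  by have [[w Aw]|nA] := pselect (exists w', A w'); [exists w|exists x0].
pose rep v := pick (orb v).
have repP v : exists g, phi g (rep v) = v.
  by apply: (pickP (orb v)); exists v, 1%g; rewrite (phi1 hact).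
(* [pick] depends only on the orbit as a set, so a whole orbit shares one representative. *)
have rep_act g v : rep (phi g v) = rep v.
  congr pick; apply/funext => w; apply/propext; split => -[h hw].
    by exists (g^-1 * h)%g; rewrite (phiM hact) hw (phiK hact).
  by exists (g * h)%g; rewrite (phiM hact) hw.
have [tr trP] := choice repP.
have tr_act g v : tr (phi g v) = (g * tr v)%g.
  by apply: (act_free hact hfree (x := rep v)); rewrite -{1}(rep_act g) trP (phiM hact) trP.
pose f c v := parity c (tr v).
have f_act c g v : f c (phi g v) = parity c g (+) f c v by rewrite /f tr_act parityM.
pose beta c : {ffun 'I_(size Q) -> bool} :=
  [ffun i => let r := nth (x0, x0) Q (nat_of_ord i) in f c r.1 (+) f c r.2].
suff /leq_card : injective beta.
  by rewrite !card_ffun !card_ord card_bool leq_exp2l.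
move=> c c' bcc'.
pose d v := f c v (+) f c' v.
have d_edge v w : e v w -> d v = d w.
  move=> /cQ[r rQ [g hg]].
  have rlt : index r Q < size Q by rewrite index_mem.
  have := congr1 (fun b : {ffun _} => b (Ordinal rlt)) bcc'.
  rewrite !ffunE /= nth_index // => h.
  have : d (phi g r.1) = d (phi g r.2).
    rewrite /d !f_act; move: h.
    move: (f c r.1) (f c r.2) (f c' r.1) (f c' r.2) (parity c g) (parity c' g).
    by do 6 case.
  by case: hg => -[-> ->].
have d_const v w : d v = d w.
  have [p pp <-] := tree_path ht v w.
  by elim: p v pp => //= y p IHp v /andP[/d_edge -> /IHp].
(* Moving by the generator [i] changes [d] by [c i (+) c' i], which must therefore vanish. *)
apply/ffunP => i; have := d_const (phi (gen (i, false)) x0) x0.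
rewrite /d !f_act !parity_gen /=.
by case: (c i); case: (c' i); case: (f c x0); case: (f c' x0).
Qed.

End Rank.

(** * The equality case *)

Section HalfTrees.
Variable k : nat.
Hypothesis hk : 2 <= k.
Implicit Types (a b : letter k) (g h : free_group k) (u : seq (letter k)).

(* The elements of [F] on the far side of the edge from [h] to [h * gen a]. *)
Definition beyond h a g := ohead (val (h^-1 * g)%g) == Some a.

Lemma beyondM c h a g : beyond (c * h)%g a (c * g)%g = beyond h a g.
Proof. by rewrite /beyond invgM -mulgA mulKg. Qed.

Lemma beyond_swap h a g : beyond (h * gen a)%g (linv a) g = ~~ beyond h a g.
Proof.
rewrite /beyond invgM -mulgA -gen_linv; set f := (h^-1 * g)%g.
have -> : val (gen (linv a) * f)%g = push (linv a) (val f) by [].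
have := valP f.
case: (val f) => [|b u] /= ru; first by rewrite eqxx.
rewrite linvK; have [ba|ba] := eqVneq b a.
  rewrite ba /= eqxx; case: u ru => [//|c u] /= /andP[+ _]; rewrite ba.
  by move=> /negPf h1; apply/negbTE; apply/eqP => -[e]; rewrite e eqxx in h1.
by rewrite eqxx; apply/esym/eqP => -[e]; rewrite e eqxx in ba.
Qed.

Lemma beyond_prefix u a g : reduced (rcons u a) ->
  beyond (fgw u) a g = prefix (rcons u a) (val g).
Proof.
move=> rua; have ru : reduced u by move: rua; rewrite -cats1 => /reduced_catl.
apply/idP/idP; rewrite /beyond.
  set f := ((fgw u)^-1 * g)%g => hf.
  have gE : g = (fgw u * f)%g by rewrite /f mulKVg.
  have := valP f; case fE : (val f) hf => [|b v] //= /eqP[ba] rv; rewrite ba in fE rv.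
  have -> : val g = u ++ a :: v.
    rewrite gE -(fgwK f) fE -fgw_cat val_fgw // -cat1s reduced_overlap //.
    by rewrite cats1.
  by rewrite -cat_rcons prefix_prefix.
move=> /prefixP[v gv]; rewrite -(fgwK g) gv -cats1 -catA fgw_cat mulKg val_fgw //=.
by have := valP g; rewrite gv -cats1 -catA => /reduced_catr.
Qed.

Lemma letter_notin (a b : letter k) : exists c, (c != a) && (c != b).
Proof.
apply: contrapT => h; have : size (enum {: letter k}) <= size [:: a; b].
  apply: uniq_leq_size; first exact: enum_uniq.
  move=> c _; rewrite !inE; apply/negPn/negP; rewrite negb_or => hc.
  by apply: h; exists c.
by rewrite -cardE card_letter /=; lia.
Qed.

(** Append to [g] a high power of a letter that cancels neither against the end of [h^-1 g] nor
    against that of [h'^-1 g]; first letters are then preserved. *)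
Lemma beyond_unbounded h a h' a' g : beyond h a g -> beyond h' a' g ->
  forall n, exists g', [/\ beyond h a g', beyond h' a' g' & n <= wlen g'].
Proof.
rewrite /beyond; set f := (h^-1 * g)%g; set f' := (h'^-1 * g)%g => hf hf' n.
have [b /andP[b1 b2]] := letter_notin (linv (last a (val f))) (linv (last a' (val f'))).
have rb m : reduced (nseq m b).
  elim: m => //= -[|m] //= rm.
  by move: rm; rewrite /reduced /= => ->; rewrite andbT eq_sym linv_neq.
have ext (c : letter k) (w : free_group k) : ohead (val w) == Some c -> b != linv (last c (val w)) ->
    forall m, val (w * fgw (nseq m b))%g = val w ++ nseq m b.
  move=> hw bw m; rewrite -{1}(fgwK w) -fgw_cat.
  move: (val w) (valP w) hw bw => u ru hu bu; rewrite val_fgw // reduced_cat ru rb /=.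
  by case: u hu bu {ru} => // d v _ /=; case: m.
exists (g * fgw (nseq (n + wlen h) b))%g; rewrite !mulgA -/f -/f'.
rewrite (ext _ _ hf b1) (ext _ _ hf' b2).
have nilc c (v v' : seq (letter k)) : ohead v == Some c -> ohead (v ++ v') == Some c by case: v.
split; [exact: nilc|exact: nilc|].
set g' := (g * _)%g; have : wlen (h^-1 * g')%g <= wlen h + wlen g'.
  by rewrite -(wlen_inv h) wlenM.
rewrite /g' mulgA -/f {1}/wlen (ext _ _ hf b1) size_cat size_nseq; lia.
Qed.

(** A counterexample lies in the first half-tree and in the opposite of the second, so these meet in
    arbitrarily long elements. In particular, half-trees that differ by a finite set are equal. *)
Lemma beyond_le h a h' a' N : (forall g, N <= wlen g -> beyond h a g -> beyond h' a' g) ->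
  forall g, beyond h a g -> beyond h' a' g.
Proof.
move=> hN g hg; apply/negPn/negP; rewrite -beyond_swap => hg'.
have [g' [h1 h2 h3]] := beyond_unbounded hg hg' N.
by move: h2; rewrite beyond_swap (hN _ h3 h1).
Qed.

Lemma beyond_gen h b a : ~~ beyond h b 1%g -> beyond h b (gen a) -> h = 1%g /\ b = a.
Proof.
rewrite /beyond mulg1 => n1 ha.
have : val h^-1%g = [::] /\ b = a; last first.
  by move=> [h1 ->]; split => //; apply/invg_inj/val_inj; rewrite h1.
have := valP h^-1%g; move: ha n1; rewrite -[in X in X -> _](fgwK h^-1%g) -fgw1 -fgw_cat.
case: (lastP (val h^-1%g)) => [|u c]; first by rewrite /= => /eqP[<-].
move=> ha /negP n1 ruc; exfalso; apply: n1; move: ha; rewrite cats1.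
have [ca|ca] := eqVneq a (linv c).
  rewrite ca fgw_rcons fgw_rcons gen_linv mulgK val_fgw; last first.
    by move: ruc; rewrite -cats1 => /reduced_catl.
  by case: (u).
rewrite val_fgw; last by rewrite reduced_rcons ruc.
by case: (u).
Qed.

End HalfTrees.

(** * A vertex moved to neighbours by the generators *)

Section EqualityCase.
Variables (k : nat) (hk : 2 <= k).
Variables (V : eqType) (e : rel V) (phi : free_group k -> V -> V).
Hypotheses (ht : is_tree e) (hact : is_simplicial_action e phi).
Hypotheses (hfree : is_free phi).
Implicit Types (a b : letter k) (g h c : free_group k) (s t u v w x y z : V).

Local Notation side := (side e).
Local Notation dist := (dist ht).
Local Notation hside := (hside e phi).
Local Notation edge_equiv := (edge_equiv phi).

Variable x : V.
Hypothesis few_edges : forall Q : seq (V * V), uniq Q -> {in Q, forall r, e r.1 r.2} ->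
  {in Q &, forall r r', edge_equiv r r' -> r = r'} -> size Q <= k.
Hypothesis almost_half : forall s t, e s t ->
  exists h a N, forall g, N <= wlen g -> hside x s t g = beyond h a g.
Variable Q : seq (V * V).
Hypotheses (Q_edge : {in Q, forall r, e r.1 r.2}) (Q_complete : complete e phi Q).

(* [target s t] is the half-tree to which the set of [g] with [g x] beyond the
   edge from [s] to [t] is almost equal. From a vertex [y], the first edge on the
   way to an edge that is wrong for [y] is itself wrong, by nestedness of
   half-trees; crossing it removes it from the finite set of wrong edges. *)
Lemma exists_vertex : exists y, forall i : 'I_k, e y (phi (gen (i, false)) y).
Proof.
have /choice[Z ZP] (r : V * V) : exists ha : free_group k * letter k, e r.1 r.2 ->
    exists N, forall g, N <= wlen g -> hside x r.1 r.2 g = beyond ha.1 ha.2 g.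
  have [er|ner] := boolP (e r.1 r.2); last by exists (1%g, letter0 hk).
  by have [h [a [N hN]]] := almost_half er; exists (h, a) => _; exists N.
pose target s t g := beyond (Z (s, t)).1 (Z (s, t)).2 g.
have farE s t : e s t -> exists N, forall g, N <= wlen g -> hside x s t g = target s t g.
  exact: (ZP (s, t)).
have target_uniq s t h a N : e s t -> (forall g, N <= wlen g -> hside x s t g = beyond h a g) ->
    forall g, beyond h a g = target s t g.
  move=> est hN g; have [M hM] := farE s t est.
  apply/idP/idP; apply: (beyond_le hk (N := maxn N M)) => {}g;
    by rewrite geq_max => /andP[Ng Mg]; rewrite -/(target s t g) -hM // hN.
have targetM c s t g : e s t -> target (phi c s) (phi c t) (c * g)%g = target s t g.
  move=> est; have [N hN] : exists N, forall g, N <= wlen g ->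
      hside x (phi c s) (phi c t) g = target (phi c s) (phi c t) g.
    by apply: farE; rewrite (act_edge hact).
  rewrite -(@target_uniq s t (c^-1 * (Z (phi c s, phi c t)).1)%g (Z (phi c s, phi c t)).2
    (N + wlen c)) //.
    by rewrite -(beyondM c) mulKVg.
  move=> f Nf; rewrite -(beyondM c) mulKVg -(hsideM hact x s t c) hN //.
  have := wlenM c^-1%g (c * f)%g; rewrite mulKg wlen_inv; lia.
have targetC s t g : e s t -> target t s g = ~~ target s t g.
  move=> est; have ets : e t s by rewrite (tree_sym ht).
  have [N hN] := farE _ _ est.
  rewrite -[RHS]beyond_swap; apply/esym/(target_uniq _ _ _ _ N) => // f Nf.
  by rewrite beyond_swap -/(target s t f) -hN // (hside_swap phi ht _ _ est).
have target_le s t s' t' : e s t -> e s' t' -> (forall v, side s t v -> side s' t' v) ->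
    forall g, target s t g -> target s' t' g.
  move=> est est' le; have [N hN] := farE _ _ est; have [M hM] := farE _ _ est'.
  apply: (beyond_le hk (N := maxn N M)) => g; rewrite geq_max => /andP[Ng Mg].
  rewrite -/(target s t g) -/(target s' t' g) -hN // -hM //; exact: le.
pose wrong y (st : V * V) := [/\ e st.1 st.2, side st.1 st.2 y & ~~ target st.1 st.2 1%g].
have descent n (L : seq (V * V)) : size L <= n -> forall y,
    (forall st, wrong y st -> st \in L) -> exists y', forall st, ~ wrong y' st.
  elim: n L => [|n IHn] L sL y hL.
    by exists y => st /hL; move: sL; rewrite leqn0 => /nilP ->.
  have [[[s t] [/= est sy nt]]|none] := pselect (exists st, wrong y st); last first.
    by exists y => st wst; apply: none; exists st.
  have ys : dist s y != 0.
    by apply: contraTneq sy => /dist_eq0 <-; rewrite (side_tail ht est).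
  have [v eyv dv] : exists2 v, e y v & dist s y = (dist s v).+1.
    by apply: dist_next; rewrite distC.
  have evy : e v y by rewrite (tree_sym ht).
  have nvys : ~~ side v y s.
    by apply/negP => /(dist_side ht evy); lia.
  have wvy : wrong y (v, y).
    split => //=; first exact: side_head.
    apply: contra nt; apply: (target_le v y s t) => // z /asboolP[p pp lp].
    apply/negPn/negP => nz; have pe : path e z p by apply: sub_path pp => ? ? /andP[].
    have := path_enter ht pe nz; rewrite lp => /(_ sy)/mem_zip_path[sp _].
    case/negP: nvys; case/splitPl: sp pp lp => p1 p2 lp1.
    rewrite cat_path last_cat lp1 => /andP[_ pp2] lp2.
    by apply/asboolP; exists p2.
  apply: (IHn (rem (v, y) L) _ v).
    by rewrite size_rem ?hL //; move: sL; case: (size L).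
  (* From [y] to [v] only the edge between them changes side: oriented towards [y] it no longer has
     [v] beyond it, and oriented towards [v] it is right because its reverse was wrong. *)
  move=> [a b] [/= eab sabv nab]; have nvyv : side v y v = false by rewrite (side_tail ht evy).
  have ne : (a, b) != (v, y).
    by apply/eqP => -[av bv]; rewrite av bv nvyv in sabv.
  have [sy'|nsy] := boolP (side a b y).
    have : (a, b) \in L by apply: hL.
    by rewrite (perm_mem (perm_to_rem (hL _ wvy))) inE (negPf ne).
  have [ay bv] := side_enter ht eyv nsy sabv.
  by move: nab; rewrite -ay -bv (targetC v y) // (negPf (let: And3 _ _ h := wvy in h)).
(* If [g] carries a listed edge [r] to a wrong edge, then at [g^-1] the half-tree of [r] and its
   target disagree, so [g^-1] lies in a fixed ball. *)
have [L hL] : exists L : seq (V * V), forall st, wrong x st -> st \in L.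
  pose Q2 := Q ++ [seq (r.2, r.1) | r <- Q].
  have Q2e r : r \in Q2 -> e r.1 r.2.
    by rewrite mem_cat => /orP[/Q_edge//|/mapP[r' /Q_edge er ->]] /=; rewrite (tree_sym ht).
  have [N hN] : exists N, forall r, r \in Q2 -> forall g, N <= wlen g ->
      hside x r.1 r.2 g = target r.1 r.2 g.
    elim: (Q2) Q2e => [|r Q' IHQ] Qe; first by exists 0.
    have [N hN] := farE r.1 r.2 (Qe r (mem_head _ _)).
    have [|M hM] := IHQ; first by move=> r' r'Q; apply: Qe; rewrite inE r'Q orbT.
    exists (maxn N M) => r'; rewrite inE => /orP[/eqP ->|r'Q] g; rewrite geq_max => /andP[Ng Mg].
      exact: hN.
    exact: hM.
  exists [seq (phi (fgw p)^-1%g r.1, phi (fgw p)^-1%g r.2) | r <- Q2,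
     p <- flatten [seq rwords k n | n <- iota 0 N]].
  move=> [s t] [/= est sx nt].
  have [r rQ2 [g [gs gt]]] : exists2 r, r \in Q2 & exists g, phi g r.1 = s /\ phi g r.2 = t.
    have [r rQ [g hg]] := Q_complete est.
    case: hg => -[gs gt]; first by exists r; [rewrite mem_cat rQ|exists g].
    exists (r.2, r.1); last by exists g.
    by rewrite mem_cat; apply/orP; right; apply/mapP; exists r.
  pose f := g^-1%g.
  apply/allpairsP; exists (r, val f); split => //=; last first.
    by rewrite (_ : fgw _ = f); [rewrite /f invgK gs gt|exact: (fgwK f)].
  apply/flatten_mapP; exists (wlen f); last by rewrite mem_rwords eqxx andbT; exact: (valP f).
  rewrite mem_iota /= add0n ltnNge; apply/negP => /(hN _ rQ2).
  rewrite -(targetM g) ?Q2e // mulgV gs gt (negPf nt) -(hsideM hact _ _ _ g) mulgV gs gt.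
  by rewrite (hside1 hact) sx.
have [y hy] := descent _ L (leqnn _) x hL.
have sideE s t g : e s t -> side s t (phi g y) = target s t g.
  have right s' t' : e s' t' -> side s' t' y -> target s' t' 1%g.
    by move=> est sy; apply/negPn/negP => nt; apply: (hy (s', t')).
  have base s' t' : e s' t' -> side s' t' y = target s' t' 1%g.
    move=> est; apply/idP/idP; first exact: right.
    apply: contraTT => ns; rewrite -(targetC s' t') //; apply: right.
      by rewrite (tree_sym ht).
    by rewrite (side_swap ht).
  move=> est; rewrite -(side_act hact g^-1%g) (phiK hact) base ?(act_edge hact) //.
  by rewrite -(targetM g^-1%g s t g) // mulVg.
have targetP s t a : e s t -> ~~ side s t y -> side s t (phi (gen a) y) -> Z (s, t) = (1%g, a).
  move=> est; rewrite -{1}(phi1 hact y) !sideE // => n1 h1.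
  by have [z1 z2] := beyond_gen n1 h1; rewrite (surjective_pairing (Z (s, t))) z1 z2.
(* An equivalence preserving orientation fixes the base point of the label, hence is trivial; one
   reversing it would identify a generator with the inverse of one. *)
have equivZ r r' (i j : 'I_k) : e r.1 r.2 -> e r'.1 r'.2 ->
    Z r = (1%g, (i, false)) -> Z r' = (1%g, (j, false)) -> edge_equiv r r' -> r = r'.
  move=> er er' Zr Zr' [g hg].
  have n1 : target r.1 r.2 1%g = false by rewrite /target -surjective_pairing Zr.
  have h1 : target r.1 r.2 (gen (i, false)).
    by rewrite /target -surjective_pairing Zr; exact: eqxx.
  have T f : target r'.1 r'.2 (g * f)%g = beyond g^-1%g (j, false) f.
    by rewrite /target -surjective_pairing Zr' /= -[RHS](beyondM g) mulgV.
  case: hg => -[g1 g2].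
    have Tr f : beyond g^-1%g (j, false) f = target r.1 r.2 f by rewrite -T -g1 -g2 targetM.
    have [||gV _] := @beyond_gen k g^-1%g (j, false) (i, false); rewrite ?Tr ?n1 //.
    move: g1 g2; rewrite -[g]invgK gV invg1 !(phi1 hact).
    by case: (r) => ? ?; case: (r') => ? ? /= -> ->.
  have Tr f : beyond (g^-1 * gen (j, false))%g (linv (j, false)) f = target r.1 r.2 f.
    by rewrite beyond_swap -T -targetC // -g1 -g2 targetM.
  by have [||_] := @beyond_gen k (g^-1 * gen (j, false))%g (linv (j, false)) (i, false);
    rewrite ?Tr ?n1.
have gen_far i : dist y (phi (gen (i, false)) y) != 0.
  by apply/eqP => /dist_eq0/esym/hfree/(congr1 val).
have toward i s t : e s t -> ~~ side s t y ->
    dist (phi (gen (i, false)) y) s = (dist (phi (gen (i, false)) y) t).+1 ->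
    Z (s, t) = (1%g, (i, false)).
  move=> est ns dst; apply: targetP => //; apply/negPn/negP => /(dist_Nside ht est).
  by rewrite dst; lia.
have /choice[W WP] i : exists w, [/\ e y w, Z (y, w) = (1%g, (i, false)) &
    dist (phi (gen (i, false)) y) y = (dist (phi (gen (i, false)) y) w).+1].
  have [w eyw dw] := dist_next (gen_far i); exists w; split => //.
  by apply: toward => //; rewrite (side_tail ht).
exists y => i; have [eyw Zw dw] := WP i; set w := W i in eyw Zw dw.
apply: (dist_eq1 (ht := ht)); apply/eqP/negPn/negP => d1.
have [|w2 eww2 dw2] := @dist_next _ _ ht w (phi (gen (i, false)) y).
  apply: contra d1 => /eqP w0; by rewrite (distC ht y) dw (distC ht _ w) w0.
have Zw2 : Z (w, w2) = (1%g, (i, false)).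
  apply: toward => //; apply/negP => /(dist_side ht eww2).
  have := dist_edge_le ht y eyw; rewrite dist0 => yw ww2.
  have /dist_eq0 yw2 : dist y w2 = 0 by lia.
  by move: dw2; rewrite -yw2; lia.
(* If [gen (i, false)] moved [y] further than one step, the second edge on the way would join the
   [k] first edges as a further orbit, against [few_edges]. *)
pose Q' := (w, w2) :: [seq (y, W j) | j <- enum 'I_k].
have Q'P r : r \in Q' -> e r.1 r.2 /\ exists j : 'I_k, Z r = (1%g, (j, false)).
  rewrite inE => /orP[/eqP ->|/mapP[j _ ->]]; first by split => //; exists i.
  by have [? ? _] := WP j; split => //; exists j.
have : size Q' <= k; last by rewrite /= size_map size_enum_ord ltnn.
apply: few_edges.
- rewrite /= map_inj_uniq ?enum_uniq ?andbT.
    apply/mapP => -[j _ [wy _]]; by rewrite wy (tree_irr ht) in eyw.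
  by move=> j l [Wjl]; have [_ + _] := WP j; have [_ + _] := WP l; rewrite Wjl => -> [].
- by move=> r /Q'P[].
move=> r r' /Q'P[er [j Zr]] /Q'P[er' [l Zr']]; exact: (equivZ _ _ _ _ er er' Zr Zr').
Qed.

End EqualityCase.

(** * The dichotomy *)

Section StretchingFactor.
Local Open Scope classical_set_scope.
Local Open Scope ring_scope.
Variables (R : realType) (k : nat) (hk : (2 <= k)%N).
Variables (mu : probability (boundary_borel hk) R).
Hypothesis hmu : is_uniform mu.
Variables (V : eqType) (e : rel V) (phi : free_group k -> V -> V).
Hypotheses (ht : is_tree e) (hact : is_simplicial_action e phi).
Implicit Types (w : nat -> letter k) (l : R).

Local Notation dist := (dist ht).
Local Notation disp := (disp R phi ht).

Lemma lw_inf_word (z : boundary hk) : inf_word (lw z).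
Proof. exact: set_mem (valP z). Qed.

Lemma stretching_of_disp x0 l :
  (forall w, inf_word w -> generic R w -> (fun n => disp x0 w n / n%:R) @ \oo --> l) ->
  is_stretching_factor e phi mu l.
Proof.
move=> hl x; apply: ae_imply (ae_generic hmu) => z gz.
have := hl _ (@lw_inf_word z) gz.
apply: (@cvg_bounded_diff _ _ _ ((dist x0 x)%:R + (dist x0 x)%:R)) => n.
have -> : wprefix (z : boundary hk) n = fgw (mkseq (lw (z : boundary hk)) n).
  by apply: val_inj; rewrite val_fgw //; exact: reduced_mkseq (@lw_inf_word z).
rewrite (path_distE R ht) /disp; set g := fgw _.
have h1 := dist_triangle ht x0 x (phi g x0); have h2 := dist_triangle ht x (phi g x) (phi g x0).
have h3 := dist_triangle ht x x0 (phi g x); have h4 := dist_triangle ht x0 (phi g x0) (phi g x).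
rewrite (dist_act ht hact) (distC ht x x0) in h2 h3; rewrite (dist_act ht hact) in h4.
rewrite ler_norml lerBlDl -!natrD lerNl opprB lerBlDl -natrD !ler_nat.
by apply/andP; split; lia.
Qed.

(** Two sets of full measure meet, so two almost sure limits agree. *)
Lemma stretchingE l : is_stretching_factor e phi mu l -> stretching_factor e phi mu = l.
Proof.
move=> hl; have [x] : inhabited V by case: ht.
have : is_stretching_factor e phi mu (stretching_factor e phi mu).
  exact: (xgetPex 0 (P := [set l | is_stretching_factor e phi mu l]) (ex_intro _ l hl)).
move=> /(_ x) h1; have h2 := hl x.
have mu1 : (mu setT > 0)%E by rewrite probability_setT lte01.
have PF := ae_properfilter_algebraOfSetsType mu1.
have [z [z1 z2]] := filter_ex (filterI h1 h2).
exact: (cvg_unique _ z1 z2).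
Qed.

Lemma exists_generic : exists2 w : nat -> letter k, inf_word w & generic R w.
Proof.
have mu1 : (mu setT > 0)%E by rewrite probability_setT lte01.
have PF := ae_properfilter_algebraOfSetsType mu1.
have [z gz] := filter_ex (ae_generic hmu).
by exists (lw (z : boundary hk)) => //; exact: lw_inf_word.
Qed.

End StretchingFactor.

Section SimpleTwist.
Local Open Scope classical_set_scope.
Local Open Scope ring_scope.
Variable k : nat.
Implicit Types (g h : free_group k).

Lemma wlen_morph_le (rho : free_group k -> free_group k) :
  {morph rho : g h / (g * h)%g} -> (forall a, (wlen (rho (gen a)) <= 1)%N) ->
  forall g, (wlen (rho g) <= wlen g)%N.
Proof.
move=> rM r1 g; have rho1 : rho 1%g = 1%g.
  by apply: (mulgI (rho 1%g)); rewrite -rM !mulg1.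
rewrite -{1}(fgwK g) /wlen -/(wlen _); elim: (val g) => [|a s IHs].
  by rewrite fgw_nil rho1.
by rewrite fgw_cons rM (leq_trans (wlenM _ _)) //= -add1n leq_add.
Qed.

(** A relabeling preserves word length, since it and its inverse send generators to generators;
    conjugation by [g0] changes it by at most [2 * wlen g0]. *)
Lemma simple_wlen alpha : is_simple alpha -> exists C, forall u : free_group k,
  exists2 c, alpha c = u & (wlen c <= wlen u + C)%N && (wlen u <= wlen c + C)%N.
Proof.
move=> [rho [iota [[[rM [rho' rK r'K]] [sigma rS]] [g0 iE] aE]]].
have r'M : {morph rho' : g h / (g * h)%g}.
  by move=> g h; apply: (can_inj rK); rewrite r'K rM !r'K.
have rlen g : wlen (rho g) = wlen g.
  apply/eqP; rewrite eqn_leq (wlen_morph_le rM) => [|a]; last by rewrite rS.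
  rewrite -{1}(rK g) (wlen_morph_le r'M) // => a.
  by rewrite -[a](permKV sigma) -rS rK.
exists (2 * wlen g0)%N => u; exists (rho' (g0 * u * g0^-1)%g).
  by rewrite aE /= r'K iE conjgE !mulgA mulVg mul1g mulgKV.
rewrite -(rlen (rho' _)) r'K; set v := (g0 * u * g0^-1)%g.
have h1 := wlenM (g0 * u)%g g0^-1%g; have h2 := wlenM g0 u.
have h3 := wlenM (g0^-1 * v)%g g0; have h4 := wlenM g0^-1%g v.
rewrite wlen_inv in h1 h4.
have uE : (g0^-1 * v * g0)%g = u by rewrite /v -!mulgA mulVg mulg1 mulKg.
rewrite uE in h3; rewrite -/v in h1.
have := leq_trans h1 (leq_add h2 (leqnn _)); have := leq_trans h3 (leq_add h4 (leqnn _)).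
by clear; lia.
Qed.

End SimpleTwist.

Section CayleyCase.
Local Open Scope classical_set_scope.
Local Open Scope ring_scope.
Variables (R : realType) (k : nat).
Variables (V : eqType) (e : rel V) (phi : free_group k -> V -> V).
Hypotheses (ht : is_tree e) (hact : is_simplicial_action e phi).
Implicit Types (g h : free_group k).

Local Notation dist := (dist ht).

Lemma cayley_adjP g h : reflect (exists a, h = (g * gen a)%g) (cayley_adj g h).
Proof. by apply: (iffP existsP) => -[a /eqP hE]; exists a. Qed.

Lemma cayley_dist (f : free_group k -> V) : bijective f ->
  (forall g h, e (f g) (f h) = cayley_adj g h) -> forall g, dist (f 1%g) (f g) = wlen g.
Proof.
move=> [f' fK f'K] fe g; apply/eqP; rewrite eqn_leq; apply/andP; split.
  rewrite -{1}(fgwK g) /wlen; elim/last_ind: (val g) => [|s a IHs].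
    by rewrite fgw_nil dist0.
  rewrite size_rcons (leq_trans (dist_edge_le ht (f 1%g) (s := f (fgw s)) _)) //.
  by rewrite fe; apply/cayley_adjP; exists a; rewrite fgw_rcons.
have far p : forall h, path e (f h) p -> last (f h) p = f g -> (wlen (h^-1 * g)%g <= size p)%N.
  elim: p => [|v p IHp] h /=; first by move=> _ /(can_inj fK) ->; rewrite mulVg.
  rewrite -(f'K v) fe => /andP[/cayley_adjP[a ->] pp] lp.
  have -> : (h^-1 * g = gen a * ((h * gen a)^-1 * g))%g by rewrite invgM -mulgA mulKVg.
  by rewrite (leq_trans (wlenM _ _)) // wlen_gen add1n ltnS IHp.
have [p [pp lp <-]] := dist_path ht (f 1%g) (f g).
by have := far p 1%g pp lp; rewrite invg1 mul1g.
Qed.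

Lemma cayley_disp (alpha : free_group k -> free_group k) w (f : free_group k -> V) :
  is_simple alpha -> bijective f -> (forall g h, e (f g) (f h) = cayley_adj g h) ->
  (forall g h, f (g * h)%g = phi (alpha g) (f h)) -> inf_word w ->
  (fun n => disp R phi ht (f 1%g) w n / n%:R) @ \oo --> (1 : R).
Proof.
move=> /simple_wlen[C hC] fb fe fM hw.
apply: (@cvg_bounded_diff _ (fun n => n%:R) _ C%:R) => [n|]; last first.
  apply: cvg_near_cst; near=> n; rewrite divff // pnatr_eq0 -lt0n.
  by near: n; exists 1%N.
rewrite /disp; have := wlen_fgw (reduced_mkseq n hw); rewrite size_mkseq.
move: (fgw _) => u un; have [c cu /andP[h1 h2]] := hC u.
rewrite -cu -fM mulg1 (cayley_dist fb fe) ler_norml lerBlDl -!natrD lerNl opprB lerBlDl -natrD.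
by rewrite !ler_nat; apply/andP; split; lia.
Unshelve. all: by end_near.
Qed.

Hypotheses (hfree : is_free phi) (hmin : is_minimal e phi).

(** The orbit of [y] is an invariant subtree, hence everything by minimality, and freeness makes the
    orbit map injective. An edge from [y] to [c y] other than those of the generators would close a
    cycle with the path through the prefixes of [c]. *)
Lemma cayley_of_vertex y : (forall i : 'I_k, e y (phi (gen (i, false)) y)) ->
  cayley_isomorphic e phi.
Proof.
move=> hy; have ya (a : letter k) : e y (phi (gen a) y).
  case: a => i [] //; have -> : (i, true) = linv (i, false) by [].
  by rewrite -(act_edge hact (gen (i, false))) gen_linv (phiKV hact) (tree_sym ht).
have surj v : exists g, phi g y = v.
  suff : [set v | exists g, phi g y = v] = setT by move/seteqP => [_ /(_ v I)].
  apply: hmin; last by move=> g x [h <-]; exists (g * h)%g; rewrite (phiM hact).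
  split; first by exists y, 1%g; rewrite (phi1 hact).
  move=> _ _ [g <-] [h <-]; rewrite -(mulKVg g h); move: (g^-1 * h)%g => {h}.
  elim/free_group_ind => [|h a [p [pp lp ps]]]; first by exists [::]; rewrite mulg1.
  exists (rcons p (phi (g * (h * gen a))%g y)); split.
  - rewrite rcons_path pp lp mulgA [phi (_ * gen a)%g _](phiM hact) (act_edge hact); exact: ya.
  - by rewrite last_rcons.
  by move=> z; rewrite mem_rcons inE => /orP[/eqP ->|/ps//]; exists (g * (h * gen a))%g.
have [f' f'P] := choice surj.
exists (fun g => phi g y); split.
- exists f' => [g|v]; last exact: f'P.
  by apply: (act_free hact hfree (x := y)); rewrite f'P.
- move=> g h; apply/idP/cayley_adjP => [egh|[a ->]]; last first.
    by rewrite (phiM hact) (act_edge hact).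
  have {egh} : e y (phi (g^-1 * h)%g y).
    by rewrite -(act_edge hact g) -(phiM hact) mulKVg.
  rewrite -{2}(mulKVg g h); move: (g^-1 * h)%g => c.
  have -> : c = fgw (val c) by rewrite fgwK.
  case/lastP: (val c) (valP c) => [|s0 a] rs eys.
    by move: eys; rewrite fgw_nil (phi1 hact) (tree_irr ht).
  set s := rcons s0 a in rs eys *.
  pose vert i := phi (fgw (take i s)) y.
  have vp : sorted e (mkseq vert (size s).+1).
    apply/(sortedP y) => i; rewrite size_mkseq ltnS => is_.
    rewrite !nth_mkseq //; last exact: ltnW.
    by rewrite /vert (take_nth a is_) fgw_rcons (phiM hact) (act_edge hact).
  have vu : uniq (mkseq vert (size s).+1).
    apply/mkseq_uniqP => i j; rewrite !inE !ltnS => iN jN /(act_free hact hfree)/(congr1 (@wlen k)).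
    by rewrite !wlen_fgw ?reduced_take // !size_takel.
  have vE : mkseq vert (size s).+1 = y :: [seq vert i | i <- iota 1 (size s)].
    by rewrite /mkseq /= {1}/vert take0 fgw_nil (phi1 hact).
  rewrite vE in vp vu; have := tree_uniq_edge ht eys vp vu.
  rewrite {1 3}/s size_rcons -[(size s0).+1]addn1 iotaD map_cat last_cat /= => /(_ _)/(congr1 size).
  rewrite size_cat size_map size_iota /= addn1 => h0.
  have /eqP : size s0 = 0%N.
    by apply: succn_inj; apply: h0; rewrite /vert add1n take_oversize ?size_rcons.
  by rewrite size_eq0 /s => /eqP ->; exists a; rewrite /= fgw1.
by move=> g h; rewrite (phiM hact).
Qed.

End CayleyCase.

Section Gap.
Local Open Scope classical_set_scope.
Local Open Scope ring_scope.
Variables (R : realType) (k : nat) (hk : (2 <= k)%N).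
Variables (V : eqType) (e : rel V) (phi : free_group k -> V -> V).
Hypotheses (ht : is_tree e) (hact : is_simplicial_action e phi).
Hypotheses (hinv : without_inversions e phi) (hfree : is_free phi).
Hypothesis hmin : is_minimal e phi.
Implicit Types (r : V * V) (Q : seq (V * V)) (s t : V).

Local Notation hside := (hside e phi).
Local Notation edge_equiv := (edge_equiv phi).

Let q : R := 2 * k%:R - 1.

Lemma edge_equiv_sym r r' : edge_equiv r r' -> edge_equiv r' r.
Proof.
by move=> [g [[h1 h2]|[h1 h2]]]; exists g^-1%g; rewrite -h1 -h2 !(phiK hact); [left|right].
Qed.

Definition edge_reps Q :=
  [/\ uniq Q, {in Q, forall r, e r.1 r.2} & {in Q &, forall r r', edge_equiv r r' -> r = r'}].

Variables (x : V) (w : nat -> letter k) (l : R).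
Hypotheses (hw : inf_word w) (gw : generic R w).
Hypothesis hl : (fun n => disp R phi ht x w n / n%:R) @ \oo --> l.

(* Applying [cost_le_stretch] to both orientations of every edge of [Q] saves a
   factor of two. *)
Lemma edge_reps_cost Q n : edge_reps Q ->
  {in Q, forall r, coboundary_in e phi n.+1 x r.1 r.2} ->
  \sum_(r <- Q) (cost n.+1 (fun p => hside x r.1 r.2 (fgw p)))%:R <= l * (k%:R * q ^+ (2 * n).+1).
Proof.
move=> [uQ eQ iQ] cQ; pose rv r : V * V := (r.2, r.1); pose Q2 := Q ++ map rv Q.
have rvK : involutive rv by case.
have mem2 r : r \in Q2 -> exists2 r0, r0 \in Q & r = r0 \/ r = rv r0.
  by rewrite mem_cat => /orP[rQ|/mapP[r0 r0Q ->]]; [exists r; [|left]|exists r0; [|right]].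
have noflip r g : r \in Q -> phi g r.1 = r.2 -> phi g r.2 = r.1 -> False.
  by move=> /eQ er h1 h2; apply: (hinv er (conj h1 h2)).
have uQ2 : uniq Q2.
  rewrite cat_uniq uQ (map_inj_uniq (inv_inj rvK)) uQ andbT /=.
  apply/hasPn => _ /mapP[r rQ ->]; apply/negP => rvQ.
  have E : r = rv r by apply: iQ => //; exists 1%g; right; rewrite !(phi1 hact).
  have := eQ r rQ; case: (r) E => s t [-> _] /=; by rewrite (tree_irr ht).
have eQ2 : {in Q2, forall r, e r.1 r.2}.
  by move=> r /mem2[r0 /eQ er0 [->|->]] //=; rewrite (tree_sym ht).
have cQ2 : {in Q2, forall r, coboundary_in e phi n.+1 x r.1 r.2}.
  move=> r /mem2[r0 r0Q [->|->]] /=; first exact: cQ.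
  by apply: (coboundary_in_swap ht); [exact: eQ|exact: cQ].
have iQ2 : inequivalent phi Q2.
  move=> r r' /mem2[r0 r0Q [->|->]] /mem2[r0' r0Q' [->|->]] g /= h1 h2.
  - by apply: iQ => //; exists g; left.
  - have E : r0 = r0' by apply: iQ => //; exists g; right.
    by case: (noflip r0 g r0Q); rewrite ?h1 ?h2 E.
  - have E : r0 = r0' by apply: iQ => //; exists g; right.
    by case: (noflip r0 g r0Q); rewrite ?h1 ?h2 E.
  - by congr rv; apply: iQ => //; exists g; left.
have := cost_le_stretch hk hact hfree uQ2 iQ2 cQ2 erefl hw gw hl.
rewrite big_cat big_map /=.
have -> : \sum_(r <- Q) (cost n.+1 (fun p => hside x r.2 r.1 (fgw p)))%:R =
    \sum_(r <- Q) (cost n.+1 (fun p => hside x r.1 r.2 (fgw p)))%:R :> R.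
  apply: eq_big_seq => r rQ; rewrite -costC; congr (cost _ _)%:R; apply/funext => p /=.
  by rewrite (hside_swap phi ht x _ (eQ _ rQ)) negbK.
by rewrite -/q; lra.
Qed.

Lemma cost_ge s t n : e s t -> coboundary_in e phi n.+1 x s t ->
  let U := fun p => hside x s t (fgw p) in
  q ^+ (2 * n).+1 <= (cost n.+1 U)%:R /\
  (q ^+ (2 * n).+1 + q ^+ (2 * n) <= (cost n.+1 U)%:R \/ half_tree n.+1 U).
Proof.
move=> est cN U.
have [h1 h2] := isoperimetry hk (has_hside ht hact hinv hmin est cN)
  (has_hsideC ht hact hinv hmin est cN).
have -> : q = ((2 * k).-1)%:R by rewrite natr_q.
by rewrite -!natrX -natrD !ler_nat.
Qed.

Hypothesis l_small : l < 1 + 1 / (k%:R * q).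

(** Each orbit costs at least [1 / k], so their number is at most [l * k < k + 1 / q], which is
    below [k + 1]. *)
Lemma small_reps Q : edge_reps Q -> (size Q <= k)%N.
Proof.
move=> repQ; have [uQ eQ iQ] := repQ; have [N hN] := coboundary_seq ht hact hfree x eQ.
have {}hN : {in Q, forall r, coboundary_in e phi N.+1 x r.1 r.2}.
  by move=> r /hN; apply: coboundary_inW.
have := edge_reps_cost repQ hN; have q3 := qr_ge3 R hk; rewrite -/q in q3.
have qN : 0 < q ^+ (2 * N).+1 by rewrite exprn_gt0 //; lra.
have k2 : 2 <= k%:R :> R by rewrite ler_nat.
have : (size Q)%:R * q ^+ (2 * N).+1 <=
    \sum_(r <- Q) (cost N.+1 (fun p => hside x r.1 r.2 (fgw p)))%:R :> R.
  rewrite mulr_natl -iter_addr_0 -count_predT -big_const_seq big_seq [leRHS]big_seq.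
  by apply: ler_sum => r rQ; have [] := cost_ge (eQ _ rQ) (hN _ rQ).
move=> h1 h2; have := le_trans h1 h2; rewrite mulrA ler_pM2r // => h3.
rewrite -ltnS -(ltr_nat R) -natr1; apply: (le_lt_trans h3).
have : l * k%:R < (1 + 1 / (k%:R * q)) * k%:R by rewrite ltr_pM2r //; lra.
move=> /lt_le_trans; apply; rewrite mulrDl mul1r lerD2l.
have -> : 1 / (k%:R * q) * k%:R = q^-1.
  by rewrite div1r invfM mulrAC mulVf ?mul1r // gt_eqF //; lra.
by rewrite invf_le1 //; lra.
Qed.

Lemma complete_reps Q : edge_reps Q -> exists Q', [/\ {subset Q <= Q'}, edge_reps Q' & complete e phi Q'].
Proof.
have [n] := ubnP (k - size Q); elim: n Q => // n IHn Q hn repQ; have [uQ eQ iQ] := repQ.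
have [cQ|] := pselect (complete e phi Q); first by exists Q; split.
move=> /existsNP[v /existsNP[u /not_implyP[evu nr]]].
have nvu : (v, u) \notin Q.
  by apply/negP => vuQ; apply: nr; exists (v, u) => //; exists 1%g; left; rewrite !(phi1 hact).
have repQ1 : edge_reps ((v, u) :: Q).
  split; first by rewrite /= nvu.
    by move=> r; rewrite inE => /orP[/eqP ->|/eQ].
  move=> r r'; rewrite !inE => /orP[/eqP ->|rQ] /orP[/eqP ->|r'Q] //.
  - by move=> /edge_equiv_sym h; case: nr; exists r'.
  - by move=> h; case: nr; exists r.
  - exact: iQ.
have := small_reps repQ1; rewrite /= => sQ.
have [|Q' [sub repQ' cQ']] := IHn _ _ repQ1; first by rewrite /=; lia.
by exists Q'; split => // r rQ; apply: sub; rewrite inE rQ orbT.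
Qed.

(** Complete the edge to representatives of all orbits, of which there are at least [k]. If this one
    cost the extra [1 / (k * q)], the total would reach the excluded bound. *)
Lemma almost_half_tree s t : e s t ->
  exists h a N, forall g, (N <= wlen g)%N -> hside x s t g = beyond h a g.
Proof.
move=> est; have rep1 : edge_reps [:: (s, t)].
  split => //; first by move=> r; rewrite inE => /eqP ->.
  by move=> r r'; rewrite !inE => /eqP -> /eqP ->.
have [Q [sub repQ cQ]] := complete_reps rep1; have [uQ eQ iQ] := repQ.
have stQ : (s, t) \in Q by apply: sub; rewrite mem_head.
have kQ := rank_le_edges ht hact hfree cQ.
have [N hN] := coboundary_seq ht hact hfree x eQ.
have {}hN : {in Q, forall r, coboundary_in e phi N.+1 x r.1 r.2}.
  by move=> r /hN; apply: coboundary_inW.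
have [_ [big|[u [c [ru u0 un hu]]]]] := cost_ge est (hN _ stQ).
  exfalso; have := edge_reps_cost repQ hN; have q3 := qr_ge3 R hk; rewrite -/q in q3.
  have qN : 0 < q ^+ (2 * N) by rewrite exprn_gt0 //; lra.
  have k2 : 2 <= k%:R :> R by rewrite ler_nat.
  have : (size Q)%:R * q ^+ (2 * N).+1 + q ^+ (2 * N) <=
      \sum_(r <- Q) (cost N.+1 (fun p => hside x r.1 r.2 (fgw p)))%:R :> R.
    have -> : (size Q)%:R * q ^+ (2 * N).+1 = \sum_(r <- Q) q ^+ (2 * N).+1.
      by rewrite big_const_seq count_predT iter_addr_0 mulr_natl.
    rewrite !(bigD1_seq (s, t)) //= addrAC lerD //.
    rewrite big_seq_cond [leRHS]big_seq_cond.
    by apply: ler_sum => r /andP[rQ _]; have [] := cost_ge (eQ _ rQ) (hN _ rQ).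
  move=> h1 h2; have := le_trans h1 h2; apply/negP; rewrite -ltNge.
  have kQ' : k%:R <= (size Q)%:R :> R by rewrite ler_nat.
  apply: (@lt_le_trans _ _ (k%:R * q ^+ (2 * N).+1 + q ^+ (2 * N))); last first.
    by rewrite lerD2r ler_wpM2r // exprn_ge0 //; lra.
  have -> : k%:R * q ^+ (2 * N).+1 + q ^+ (2 * N) =
      (1 + 1 / (k%:R * q)) * (k%:R * q ^+ (2 * N).+1).
    have k0 : k%:R != 0 :> R by rewrite gt_eqF //; lra.
    have q0 : q != 0 by rewrite gt_eqF //; lra.
    by rewrite mulrDl mul1r div1r exprS mulrA mulrA mulVf ?mul1r // mulf_neq0.
  by rewrite ltr_pM2r // mulr_gt0 ?exprn_gt0 //; lra.
case: (lastP u) ru u0 un hu => // {}u a ru _ un hu.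
have far g : (N.+1 <= wlen g)%N -> hside x s t g = c (+) beyond (fgw u) a g.
  move=> Ng; rewrite beyond_prefix // -(fgwK g) -{1}(cat_take_drop N.+1 (val g)).
  rewrite (cone_side (hN _ stQ)) ?size_takel ?cat_take_drop //; last exact: (valP g).
  rewrite [LHS]hu; last by rewrite mem_rwords size_takel // eqxx andbT reduced_take //; exact: (valP g).
  rewrite val_fgw; last exact: (valP g).
  by congr addb; rewrite !prefixE take_takel.
case: c hu far => hu far; last by exists (fgw u), a, N.+1 => g /far.
by exists (fgw u * gen a)%g, (linv a), N.+1 => g /far ->; rewrite beyond_swap.
Qed.

Lemma cayley_of_small : cayley_isomorphic e phi.
Proof.
have [|Q [_ repQ cQ]] := @complete_reps [::]; first by split.
have [uQ eQ iQ] := repQ.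
have [y hy] := exists_vertex hk ht hact hfree
  (fun Q uQ eQ iQ => small_reps (And3 uQ eQ iQ)) almost_half_tree eQ cQ.
exact: (cayley_of_vertex ht hact hfree hmin hy).
Qed.

End Gap.

Local Open Scope ring_scope.

Theorem theorem7 (R : realType) (k : nat) (hk : (2 <= k)%N)
    (mu : probability (boundary_borel hk) R) (hmu : is_uniform mu)
    (V : eqType) (e : rel V) (phi : free_group k -> V -> V)
    (htree : is_tree e)
    (hact : is_simplicial_action e phi)
    (hinv : without_inversions e phi)
    (hfree : is_free phi)
    (hmin : is_minimal e phi) :
  let lambda : R := stretching_factor e phi mu in
  let case1 := exists alpha : free_group k -> free_group k,
      is_simple alpha /\ cayley_isomorphic e (phi \o alpha) in
  let case2 := 1 + 1 / (k%:R * (2 * k%:R - 1)) <= lambda in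
  [/\ case1 \/ case2, ~ (case1 /\ case2) & case1 -> lambda = 1].
Proof.
move=> lambda case1 case2.
have c1 : case1 -> lambda = 1.
  move=> [alpha [sa [f [fb fe fM]]]].
  rewrite /lambda; apply: (stretchingE htree).
  apply: (@stretching_of_disp _ _ _ _ hmu _ _ _ htree hact (f 1%g) 1) => w hw _.
  exact: (cayley_disp htree sa fb fe fM hw).
split => //; last first.
  move=> [/c1 l1]; rewrite /case2 l1 gerDl leNgt => /negP; apply.
  have q3 := qr_ge3 R hk; have k0 : 0 < k%:R :> R by rewrite ltr0n; lia.
  by rewrite divr_gt0 // mulr_gt0 //; lra.
have [x] : inhabited V by case: htree.
have [l hl] := disp_cvg R htree hact hfree x.
have lE : lambda = l.
  rewrite /lambda; apply: (stretchingE htree).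
  by apply: (@stretching_of_disp _ _ _ _ hmu _ _ _ htree hact x l).
have [h|h] := leP (1 + 1 / (k%:R * (2 * k%:R - 1))) lambda; first by right.
(* The identity suffices: the free choice of the base vertex absorbs conjugations, and relabelings
   preserve the Cayley graph. *)
left; exists id; split.
  exists id, id; split => //.
    split; first by split => //; exists id.
    by exists 1%g => a; rewrite perm1.
  by exists 1%g => g; rewrite conjg1.
have [w hw gw] := exists_generic hmu.
rewrite lE in h.
have [f [fb fe fM]] := cayley_of_small hk hact hinv hfree hmin hw gw (hl w hw gw) h.
by exists f.
Qed.
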